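(* Let $k\ge3$. On a cuboid cell $T$ let $\boldsymbol\Sigma_T$ be the space of symmetric matrix fields $\boldsymbol\sigma$ with $\sigma_{ii}\in\mathcal Q(i{:}k-2,j{:}k,l{:}k)$ for each $i$, and $\sigma_{ij}=\sigma_{ji}\in\mathcal Q(i{:}k-1,j{:}k-1,l{:}k)$ for $i\ne j$. The following degrees of freedom are unisolvent for $\boldsymbol\Sigma_T$. For each diagonal entry $\sigma_{ii}$: (a) moments of $\sigma_{ii},\partial_j\sigma_{ii},\partial_l\sigma_{ii},\partial_j\partial_l\sigma_{ii}$ on each edge $e_i$ against $\mathcal Q(i{:}k-2)$; (b) for each $j\neq i$, moments of $\sigma_{ii},\partial_l\sigma_{ii}$ on each face $F_{ij}$ against $\mathcal Q(i{:}k-2,j{:}k-4)$; (c) moments of $\sigma_{ii}$ on $T$ against $\mathcal Q(i{:}k-2,j{:}k-4,l{:}k-4)$. For each off-diagonal entry $\sigma_{ij}$, $i<j$: (a) $\sigma_{ij}$ and $\partial_l\sigma_{ij}$ at each vertex; (b) moments of $\sigma_{ij},\partial_l\sigma_{ij}$ on each edge $e_i$ against $\mathcal Q(i{:}k-3)$ and on each edge $e_j$ against $\mathcal Q(j{:}k-3)$; (c) moments of $\sigma_{ij}$ on each edge $e_l$ against $\mathcal Q(l{:}k-4)$; (d) moments of $\sigma_{ij},\partial_l\sigma_{ij}$ on each face $F_{ij}$ against $\mathcal Q(i{:}k-3,j{:}k-3)$; (e) moments of $\sigma_{ij}$ on each face $F_{il}$ against $\mathcal Q(i{:}k-3,l{:}k-4)$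 and on each face $F_{jl}$ against $\mathcal Q(j{:}k-3,l{:}k-4)$; (f) moments of $\sigma_{ij}$ on $T$ against $\mathcal Q(i{:}k-3,j{:}k-3,l{:}k-4)$. Moreover, the resulting finite element space $\boldsymbol\Sigma_h$ on $\mathcal T_h$ is $\boldsymbol H(\operatorname{curl};\mathbb S)$ conforming, i.e. $\boldsymbol\Sigma_h\subset\boldsymbol H(\operatorname{curl},\Omega;\mathbb S)$.
   Context: Coordinates are $(x_1,x_2,x_3)=(x,y,z)$, $\partial_i=\partial/\partial x_i$. Whenever indices $i,j,l$ occur together they are pairwise distinct, i.e. $\{i,j,l\}=\{1,2,3\}$. $\mathcal Q(i{:}a,j{:}b,l{:}c)$ is the space of polynomials of degree at most $a$ in $x_i$, at most $b$ in $x_j$ and at most $c$ in $x_l$ (separately); similarly with fewer variables on faces and edges; it is the zero space if some bound is negative (the corresponding degrees of freedom are then absent). $\mathbb M$, $\mathbb S$ are the real $3\times3$ matrices and the symmetric ones; $\operatorname{curl}$ acts row-wise on matrix fields; $\boldsymbol H(\operatorname{curl},\Omega;\mathbb S)=\{\boldsymbol v\in L^2(\Omega;\mathbb S):\operatorname{curl}\boldsymbol v\in L^2(\Omega;\mathbb M)\}$. $\Omega\subset\mathbb R^3$ is a contractible domain with Lipschitz boundary, partitioned by a (face-to-face) mesh $\mathcal T_h$ of axis-parallel cuboids. $e_i$ denotes an edge parallel to the $x_i$-axis; $F_{ij}=F_{ji}$ denotes a face parallel to the $x_i$- and $x_j$-axes. ''Moments of $f$ on $G$ against $P$'' means the functionals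 $\int_G f\,p$, $p\in P$ (with $p$ running over a basis of $P$ when counting). Degrees of freedom are unisolvent for a shape function space if they form a basis of its dual space. The resulting finite element space consists of all fields on $\Omega$ whose restriction to each cell is in the shape function space and such that each degree of freedom attached to a vertex, edge or face has the same value from all cells containing that vertex, edge or face. *)

(* Defs.v *)
(* Written over MathComp and MathComp-Analysis. *)
From HB Require Import structures.
From mathcomp Require Export all_boot all_order all_algebra.
From mathcomp Require Export all_classical all_reals all_analysis.

Set Implicit Arguments.
Unset Strict Implicit.
Unset Printing Implicit Defensive.
Export Order.TTheory GRing.Theory Num.Theory.
Export numFieldNormedType.Exports.

Local Open Scope classical_set_scope.
Local Open Scope ring_scope.

(* R^3 is the product R * R * R, which carries both the normed space structure
   and the product Lebesgue measure. *)
Notation R3 R := (R * R * R)%type.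

Definition ax1 : 'I_3 := Ordinal (isT : (0 < 3)%N).
Definition ax2 : 'I_3 := Ordinal (isT : (1 < 3)%N).
Definition ax3 : 'I_3 := Ordinal (isT : (2 < 3)%N).

(* One item of the list of degrees of freedom: moments of
   partials der (sigma_(row, col)), on every subentity parallel to the axes
   listed in test, against Qspace test; values at the vertices when
   test = [::]. *)
Record dofspec := Dof {
  row_ : 'I_3; col_ : 'I_3; der : seq 'I_3; test : seq ('I_3 * int) }.

Definition dofspec_to (s : dofspec) := (row_ s, col_ s, der s, test s).
Definition dofspec_of (t : 'I_3 * 'I_3 * seq 'I_3 * seq ('I_3 * int)) :=
  Dof t.1.1.1 t.1.1.2 t.1.2 t.2.
Lemma dofspec_toK : cancel dofspec_to dofspec_of. Proof. by case. Qed.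
HB.instance Definition _ := Equality.copy dofspec (can_type dofspec_toK).

Definition support_axes (s : dofspec) : seq 'I_3 := unzip1 (test s).

Definition diag_dofs (k : nat) (i j l : 'I_3) : seq dofspec :=
  [:: Dof i i [::]     [:: (i, k%:Z - 2)];
      Dof i i [:: j]    [:: (i, k%:Z - 2)];
      Dof i i [:: l]    [:: (i, k%:Z - 2)];
      Dof i i [:: j; l] [:: (i, k%:Z - 2)];
      Dof i i [::]  [:: (i, k%:Z - 2); (j, k%:Z - 4)];
      Dof i i [:: l] [:: (i, k%:Z - 2); (j, k%:Z - 4)];
      Dof i i [::]  [:: (i, k%:Z - 2); (l, k%:Z - 4)];
      Dof i i [:: j] [:: (i, k%:Z - 2); (l, k%:Z - 4)];
      Dof i i [::] [:: (i, k%:Z - 2); (j, k%:Z - 4); (l, k%:Z - 4)] ].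

Definition offdiag_dofs (k : nat) (i j l : 'I_3) : seq dofspec :=
  [:: Dof i j [::]  [::];
      Dof i j [:: l] [::];
      Dof i j [::]  [:: (i, k%:Z - 3)];
      Dof i j [:: l] [:: (i, k%:Z - 3)];
      Dof i j [::]  [:: (j, k%:Z - 3)];
      Dof i j [:: l] [:: (j, k%:Z - 3)];
      Dof i j [::] [:: (l, k%:Z - 4)];
      Dof i j [::]  [:: (i, k%:Z - 3); (j, k%:Z - 3)];
      Dof i j [:: l] [:: (i, k%:Z - 3); (j, k%:Z - 3)];
      Dof i j [::] [:: (i, k%:Z - 3); (l, k%:Z - 4)];
      Dof i j [::] [:: (j, k%:Z - 3); (l, k%:Z - 4)];
      Dof i j [::] [:: (i, k%:Z - 3); (j, k%:Z - 3); (l, k%:Z - 4)] ].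

Definition dofspecs (k : nat) : seq dofspec :=
  diag_dofs k ax1 ax2 ax3 ++ diag_dofs k ax2 ax1 ax3 ++
  diag_dofs k ax3 ax1 ax2 ++
  offdiag_dofs k ax1 ax2 ax3 ++ offdiag_dofs k ax1 ax3 ax2 ++
  offdiag_dofs k ax2 ax3 ax1.

Definition leb2 {R : realType} :
    set (measurableTypeR R * measurableTypeR R)%type -> \bar R :=
  (@lebesgue_measure R \x @lebesgue_measure R)%E.

HB.instance Definition _ (R : realType) := Measure.on (@leb2 R).

(* The product of two sigma-finite measures is sigma-finite, but the library
   instance is hidden by the one for subprobabilities. *)
Lemma sigma_finite_leb2 (R : realType) : sigma_finite setT (@leb2 R).
Proof.
have /sigma_finiteP[F [TF ndF Foo]] := sigma_finiteT (@lebesgue_measure R).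
exists (fun n => F n `*` F n).
  rewrite -setXTT TF predeqE => -[x y]; split.
    move=> [/= [n _ Fnx] [m _ Fmy]]; exists (maxn n m) => //; split.
    - by move: x Fnx; exact/subsetPset/ndF/leq_maxl.
    - by move: y Fmy; exact/subsetPset/ndF/leq_maxr.
  by move=> [n _ []/= ? ?]; split; exists n.
move=> n; have [? ?] := Foo n; split; first exact: measurableX.
by rewrite /leb2 product_measure1E// lte_mul_pinfty// ge0_fin_numE.
Qed.

HB.instance Definition _ (R : realType) :=
  @Measure_isSigmaFinite.Build _ _ _ (@leb2 R) (@sigma_finite_leb2 R).

Definition leb3 {R : realType} :
    set (measurableTypeR R * measurableTypeR R * measurableTypeR R)%type ->
    \bar R :=
  (@leb2 R \x @lebesgue_measure R)%E.

HB.instance Definition _ (R : realType) := Measure.on (@leb3 R).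

Section Space.
Context {R : realType}.

Definition coord (x : R3 R) (i : 'I_3) : R :=
  if i == ax1 then x.1.1 else if i == ax2 then x.1.2 else x.2.

Definition mkpt (f : 'I_3 -> R) : R3 R := (f ax1, f ax2, f ax3).

Definition upd (x : R3 R) (i : 'I_3) (t : R) : R3 R :=
  mkpt (fun m => if m == i then t else coord x m).

Definition unitv (i : 'I_3) : R3 R := mkpt (fun m => (m == i)%:R).

Definition partial (i : 'I_3) (f : R3 R -> R) : R3 R -> R :=
  fun x => 'D_(unitv i) f x.

(* partials [:: i; j] f = partial i (partial j f) *)
Definition partials (a : seq 'I_3) (f : R3 R -> R) : R3 R -> R :=
  foldr partial f a.

(* A bound list [:: (i, a); (j, b); (l, c)] stands for the index
   (i:a, j:b, l:c) of Q; a variable that is not listed gets bound 0, so the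
   polynomials do not depend on it.  This covers Q on faces and edges.  Bounds
   are integers: no monomial is allowed when one of them is negative, and then
   Qspace is the zero space. *)
Definition bound (d : seq ('I_3 * int)) (m : 'I_3) : int :=
  nth 0 (unzip2 d) (index m (unzip1 d)).

Definition Qspace (d : seq ('I_3 * int)) : set (R3 R -> R) :=
  [set f | exists (n : nat) (c : 'I_n -> R) (e : 'I_n -> 'I_3 -> nat),
    (forall r m, (e r m)%:Z <= bound d m) /\
    forall x, f x = \sum_r c r * \prod_m coord x m ^+ e r m].

Definition is_basis (V : lmodType R) (S : set V) (b : seq V) : Prop :=
  (forall v, v \in b -> S v) /\
  forall v, S v -> exists! c : 'rV[R]_(size b),
    v = \sum_(r < size b) c 0 r *: b`_r.

Definition linear_on (V : lmodType R) (S : set V) (phi : V -> R) : Prop :=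
  forall (a : R) u v, S u -> S v -> phi (a *: u + v) = a * phi u + phi v.

(* The functionals in N (restricted to the subspace S) are a basis of the
   dual space of S. *)
Definition unisolvent (V : lmodType R) (S : set V) (N : seq (V -> R)) : Prop :=
  (forall r, (r < size N)%N -> linear_on S (nth (fun=> 0) N r)) /\
  forall phi, linear_on S phi -> exists! c : 'rV[R]_(size N),
    forall u, S u -> phi u = \sum_(r < size N) c 0 r * nth (fun=> 0) N r u.

Definition field3 := R3 R -> 'M[R]_3.

Definition entry (s : field3) (i j : 'I_3) : R3 R -> R := fun x => s x i j.

(* Shape functions are polynomial fields on the whole of R^3: a polynomial is
   determined by its restriction to a nondegenerate cell. *)
Definition Sigma (k : nat) : set field3 :=
  [set s | (forall x, (s x)^T = s x) /\
    forall i j l : 'I_3, uniq [:: i; j; l] ->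
      Qspace [:: (i, k%:Z - 2); (j, k%:Z); (l, k%:Z)] (entry s i i) /\
      Qspace [:: (i, k%:Z - 1); (j, k%:Z - 1); (l, k%:Z)] (entry s i j)].

(* An axis-parallel box, given by its lower and upper corners.  Vertices, edges
   and faces of a cell are boxes that are degenerate in some directions. *)
Definition box := (R3 R * R3 R)%type.

Definition box_set (G : box) : set (R3 R) :=
  [set x | forall i, coord G.1 i <= coord x i <= coord G.2 i].

Definition is_cell (T : box) : Prop := forall i, coord T.1 i < coord T.2 i.

(* In direction m: the whole interval (None), or its lower (Some false) or
   upper (Some true) end point. *)
Definition subbox (T : box) (s : {ffun 'I_3 -> option bool}) : box :=
  (mkpt (fun m => if s m == Some true then coord T.2 m else coord T.1 m),
   mkpt (fun m => if s m == Some false then coord T.1 m else coord T.2 m)).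

(* The subentities of T parallel to exactly the axes in A: the vertices for
   A = [::], the edges e_i for [:: i], the faces F_ij for [:: i; j]. *)
Definition entities (T : box) (A : seq 'I_3) : seq box :=
  [seq subbox T s | s : {ffun 'I_3 -> option bool} <- enum {: {ffun 'I_3 -> option bool}}
                  & [forall m, (s m == None) == (m \in A)]].

Definition edge_moment (i : 'I_3) (E : box) (f p : R3 R -> R) : R :=
  \int[lebesgue_measure]_(t in `[coord E.1 i, coord E.2 i])
    (f (upd E.1 i t) * p (upd E.1 i t)).

Definition face_moment (i j : 'I_3) (F : box) (f p : R3 R -> R) : R :=
  \int[leb2]_(st in `[coord F.1 i, coord F.2 i] `*`
                    `[coord F.1 j, coord F.2 j])
    (let x := upd (upd F.1 i st.1) j st.2 in f x * p x).

Definition cell_moment (T : box) (f p : R3 R -> R) : R :=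
  \int[leb3]_(x in box_set T) (f x * p x).

(* For A = [::] (a vertex) the integral is a point evaluation. *)
Definition moment (A : seq 'I_3) (G : box) (f p : R3 R -> R) : R :=
  match A with
  | [::] => f G.1 * p G.1
  | [:: i] => edge_moment i G f p
  | [:: i; j] => face_moment i j G f p
  | _ => cell_moment G f p
  end.

Definition dof (s : dofspec) (G : box) (p : R3 R -> R) (u : field3) : R :=
  moment (support_axes s) G (partials (der s) (entry u (row_ s) (col_ s))) p.

(* B G d is the basis of Qspace d used for the moments on G.  At a vertex the
   only test function is 1, so that the functional is the point value. *)
Definition test_basis (B : box -> seq ('I_3 * int) -> seq (R3 R -> R))
    (G : box) (d : seq ('I_3 * int)) : seq (R3 R -> R) :=
  if d is [::] then [:: fun=> 1] else B G d.

Definition dofs (k : nat) (T : box)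
    (B : box -> seq ('I_3 * int) -> seq (R3 R -> R)) : seq (field3 -> R) :=
  flatten [seq [seq dof s G p | G <- entities T (support_axes s),
                                p <- test_basis B G (test s)]
          | s <- dofspecs k].

(* The finite element space on the mesh Th.  Fields are only constrained in the
   open cells, since components may jump across faces: u T is the polynomial
   with which s coincides in T. *)
Definition Sigma_h (k : nat) (Th : seq box) : set field3 :=
  [set s | exists u : box -> field3,
    [/\ forall T, T \in Th -> Sigma k (u T),
        forall T, T \in Th -> forall x, (box_set T)^° x -> s x = u T x &
        forall T T', T \in Th -> T' \in Th ->
        forall a, a \in dofspecs k -> (size (support_axes a) < 3)%N ->
        forall G, G \in entities T (support_axes a) ->
                  G \in entities T' (support_axes a) ->
        forall p, Qspace (test a) p -> dof a G p (u T) = dof a G p (u T')]].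

Definition contractible (Om : set (R3 R)) : Prop :=
  exists (x0 : R3 R) (H : R * R3 R -> R3 R),
    [/\ Om x0, {within `[0, 1] `*` Om, continuous H},
        forall t x, 0 <= t <= 1 -> Om x -> Om (H (t, x)),
        forall x, Om x -> H (0, x) = x & forall x, Om x -> H (1, x) = x0].

(* Near each boundary point Om is, in suitable orthonormal coordinates y centred
   at that point, the part of a cylinder that lies above a Lipschitz graph. *)
Definition lipschitz_boundary (Om : set (R3 R)) : Prop :=
  forall x0, (closure Om `\` Om^°) x0 ->
  exists (A : 'M[R]_3) (r h L : R) (g : R * R -> R),
    [/\ A *m A^T = 1%:M, 0 < r, 0 < h, L.-lipschitz g &
      forall x : R3 R,
        let y i := \sum_j A i j * (coord x j - coord x0 j) in
        `|y ax1| < r -> `|y ax2| < r -> `|y ax3| < h ->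
        (Om x <-> g (y ax1, y ax2) < y ax3)].

Definition is_domain (Om : set (R3 R)) : Prop :=
  [/\ open Om, Om !=set0 & connected Om].

(* Two distinct cells are disjoint or meet exactly in a common proper
   subentity; in particular their interiors are disjoint. *)
Definition is_mesh (Om : set (R3 R)) (Th : seq box) : Prop :=
  [/\ forall T, T \in Th -> is_cell T,
      closure Om = \bigcup_(T in [set` Th]) box_set T &
      forall T T', T \in Th -> T' \in Th -> T != T' ->
        box_set T `&` box_set T' = set0 \/
        exists (A : seq 'I_3) (G : box),
          [/\ exists m, m \notin A, G \in entities T A, G \in entities T' A &
              box_set T `&` box_set T' = box_set G]].

Definition test_function (Om : set (R3 R)) : set (R3 R -> R) :=
  [set phi |
    [/\ forall a, continuous (partials a phi),
        forall a x i, derivable (partials a phi) x (unitv i),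
        compact (closure [set x | phi x != 0]) &
        closure [set x | phi x != 0] `<=` Om]].

Definition L2 (Om : set (R3 R)) : set (R3 R -> R) :=
  [set f | f \_ Om \in Lfun leb3 2%:E].

(* w is the row-wise distributional curl of v on Om:
   w_(r,i) = d_j v_(r,l) - d_l v_(r,j) for (i, j, l) cyclic. *)
Definition weak_curl (Om : set (R3 R)) (v w : field3) : Prop :=
  forall phi, test_function Om phi -> forall r i j l : 'I_3,
    (i, j, l) \in [:: (ax1, ax2, ax3); (ax2, ax3, ax1); (ax3, ax1, ax2)] ->
    \int[leb3]_(x in Om) (w x r i * phi x) =
    \int[leb3]_(x in Om) (v x r j * partial l phi x - v x r l * partial j phi x).

(* Membership in H(curl, Om; S) is up to equality almost everywhere: v0 is a
   Borel representative of v.  The measurable sets of leb3 are the Borel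
   sets. *)
Definition Hcurl (Om : set (R3 R)) : set field3 :=
  [set v | exists v0 : field3,
    [/\ {ae leb3, forall x, Om x -> v x = v0 x},
        forall x, Om x -> (v0 x)^T = v0 x,
        forall i j, L2 Om (entry v0 i j) &
        exists w : field3,
          (forall i j, L2 Om (entry w i j)) /\ weak_curl Om v0 w]].

End Space.

(* Main.v *)
From HB Require Import structures.
Require Import Defs.
From mathcomp Require Import zify ring lra.
From mathcomp Require Import polyrcf.

(* Put [h_m = [a <> m] + [b <> m]].  The entry [(a, b)] has degree at most
   [k - 2 + h_m] in [x_m], and every degree of freedom is a tensor product of
   univariate ones: in direction [m], the derivatives of order [< h_m] at the two
   end points and the moments against [x_m ^ q], [q <= k - 2 - h_m].  A univariate
   polynomial [p] of that degree killed by these is zero: [p = w r] with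
   [w = ((x - a) (x - b)) ^ h], and the moment of [p] against [r] is the integral of
   [w r ^ 2], of constant sign.  Applying this one direction at a time shows that
   the degrees of freedom separate shape functions; they are as many as the
   dimension, hence form a basis of the dual.

   When [h_l > 0], the same argument with the condition in direction [l] replaced
   by the value at an end point shows that the entry [(a, b)] agrees on both sides
   of a face orthogonal to [x_l].  Only [h_l = 0], i.e. [a = b = l], is excluded, and
   the row-wise curl never differentiates the entry [(l, l)] along [x_l].  So in the
   sum over the cells of the divergence theorem the two sides of an interior face
   cancel, and the piecewise curl is the weak curl. *)

Set Implicit Arguments.
Unset Strict Implicit.
Unset Printing Implicit Defensive.
Local Open Scope classical_set_scope.
Local Open Scope ring_scope.

(** * Univariate polynomials *)

(** Polynomials in three variables are handled as finite sums [psum] of monomials, and moments are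
    tested against monomials only. Each functional then sends a monomial to a product of three
    univariate values, so the argument manipulates sums [\sum_r c r * \prod_m _] and no tensor
    product of spaces has to be built. Restricting to monomials costs nothing: the functionals are
    linear in the test function, so only the test space matters and not its basis [B].

    At [k = 3] the bound [k - 4 = -1] leaves no moments, and in a direction of order two the four
    Hermite data alone determine a cubic.

    Conformity meets two geometric obstacles. A field of [Sigma_h] is prescribed only in the open
    cells, hence the representative [glued], equal to it almost everywhere. And [is_mesh] speaks
    only of the union of the cells and of their pairwise intersections, so the existence of a second
    cell at an interior face has to be derived: it is found by stepping out of the first cell by
    less than the distance to any other mesh plane orthogonal to the step. *)

Section Univariate.
Context {R : realType}.
Implicit Types (p q : {poly R}) (a b x : R).

Definition prim p : {poly R} := \poly_(i < (size p).+1) (p`_i.-1 / i%:R).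

(* At [i = 0] the coefficient is [p`_0 / 0 = 0]. *)
Lemma coef_prim p i : (prim p)`_i = p`_i.-1 / i%:R.
Proof.
rewrite coef_poly; case: ltnP => // hi.
case: i hi => [|i] hi; first by rewrite invr0 mulr0.
by rewrite nth_default ?mul0r.
Qed.

Lemma deriv_prim p : (prim p)^`() = p.
Proof.
by apply/polyP => i; rewrite coef_deriv coef_prim /= -[_ *+ _]mulr_natr divfK ?pnatr_eq0.
Qed.

Lemma prim_linear : linear prim.
Proof.
move=> c p q; apply/polyP => i.
by rewrite coefD coefZ !coef_prim coefD coefZ mulrDl mulrA.
Qed.

(** The integral of [p] over [[a, b]] in algebraic form, which keeps measure theory out of the
    univariate argument; [Rintegral_horner] identifies the two. *)
Definition mom a b p := (prim p).[b] - (prim p).[a].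

Lemma mom_is_linear a b : linear (mom a b : {poly R} -> R^o).
Proof.
move=> c p q; rewrite /mom prim_linear !hornerD !hornerZ /GRing.scale /=; ring.
Qed.

HB.instance Definition _ a b :=
  GRing.isLinear.Build R {poly R} R^o _ (mom a b) (mom_is_linear a b).

Lemma momXn a b n : mom a b 'X^n = (b ^+ n.+1 - a ^+ n.+1) / n.+1%:R.
Proof.
have -> : mom a b 'X^n = (n.+1%:R^-1 *: 'X^(n.+1)).[b] - (n.+1%:R^-1 *: 'X^(n.+1)).[a].
  rewrite /mom; suff -> : prim 'X^n = n.+1%:R^-1 *: 'X^(n.+1) by [].
  apply/polyP => -[|i]; rewrite coef_prim coefZ !coefXn /= ?invr0 ?mulr0 //.
  by rewrite eqSS mulrC; case: eqP => [->|]; rewrite ?mulr0.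
rewrite !hornerZ !hornerXn; ring.
Qed.

(** The antiderivative has nonnegative increments between [a] and [b] and equal end values, so it is
    constant there, and a polynomial constant on an interval has derivative zero. *)
Lemma mom_pos_eq0 a b p : a < b -> (forall x, a < x < b -> 0 <= p.[x]) ->
  mom a b p = 0 -> p = 0.
Proof.
move=> ab p0 m0; set P := prim p.
have Pcst x : a < x < b -> P.[x] = P.[a].
  move=> /andP[ax xb].
  have [c /[!in_itv]/= /andP[ac cx] h1] := poly_mvt P ax.
  have [d /[!in_itv]/= /andP[xd db] h2] := poly_mvt P xb.
  rewrite deriv_prim in h1 h2.
  have /p0 pc : a < c < b by rewrite ac (lt_trans cx xb).
  have /p0 pd : a < d < b by rewrite db (lt_trans ax xd).
  have ax0 : 0 <= x - a by rewrite subr_ge0 ltW.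
  have xb0 : 0 <= b - x by rewrite subr_ge0 ltW.
  have := mulr_ge0 pc ax0; have := mulr_ge0 pd xb0.
  rewrite -h1 -h2; move: m0; rewrite /mom -/P; lra.
(* The denominators [i + 2] give distinct points strictly inside []a, b[], as many as the size of
   the polynomial and so more than its degree. *)
pose s := [seq a + (b - a) / (i.+2)%:R | i <- iota 0 (size (P - P.[a]%:P))].
have : P - P.[a]%:P = 0.
  apply: (@roots_geq_poly_eq0 _ _ s).
  - apply/allP => _ /mapP[i _ ->]; rewrite /root !hornerE Pcst ?subrr //.
    have i0 : 0 < (i.+2)%:R^-1 :> R by rewrite invr_gt0.
    have i1 : (i.+2)%:R^-1 < 1 :> R by rewrite invf_lt1 // ltr1n.
    rewrite ltrDl mulr_gt0 ?subr_gt0 //= -ltrBrDl gtr_pMr ?subr_gt0 //.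
  - rewrite map_inj_uniq ?iota_uniq // => i j /addrI/mulfI.
    by rewrite subr_eq0 gt_eqF// => /(_ isT)/invr_inj/eqP; rewrite eqr_nat => /eqP[].
  - by rewrite size_map size_iota.
move/(congr1 (@deriv R)); rewrite derivB derivC subr0 deriv0.
by rewrite /P deriv_prim.
Qed.

(** Hermite data of order at most two are all that occurs. For a double root, the derivative of
    [q * (X - a)] at [a] is the value of [q] there. *)
Lemma root_order_dvdp h a p : (h <= 2)%N ->
  (forall t, (t < h)%N -> (p^`(t)).[a] = 0) -> ('X - a%:P) ^+ h %| p.
Proof.
case: h => [|[|[|//]]] _ p0; first by rewrite expr0 dvd1p.
  by rewrite expr1 -root_factor_theorem /root; apply/eqP/(p0 0%N).
have /factor_theorem[q pq] : root p a by apply/eqP/(p0 0%N).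
have /factor_theorem[r qr] : root q a.
  have := p0 1%N isT; rewrite derivn1 pq derivM !hornerE derivXsubC !hornerE.
  by move/eqP; rewrite subrr mulr0 add0r.
by rewrite pq qr -mulrA -expr2 dvdp_mull.
Qed.

Lemma hermite_moments_eq0 a b h N p : a < b -> (h <= 2)%N ->
  (size p <= N.+1)%N ->
  (forall t, (t < h)%N -> (p^`(t)).[a] = 0) ->
  (forall t, (t < h)%N -> (p^`(t)).[b] = 0) ->
  (forall n, (n + h.*2 <= N)%N -> mom a b (p * 'X^n) = 0) -> p = 0.
Proof.
move=> ab h2 sp pa pb pm.
have /dvdpP[r pr] : ('X - a%:P) ^+ h * ('X - b%:P) ^+ h %| p.
  rewrite Gauss_dvdp ?root_order_dvdp //; apply/coprimep_expl/coprimep_expr.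
  by rewrite coprimep_XsubC root_XsubC gt_eqF.
have [->|p0] := eqVneq p 0 => //.
have r0 : r != 0 by apply: contra_neq p0; rewrite pr => ->; rewrite mul0r.
set w := _ ^+ _ * _ ^+ _ in pr.
have w0 : w != 0 by apply: contra_neq p0 => w0; rewrite pr w0 mulr0.
have sw : size w = h.*2.+1.
  by rewrite size_mul ?expf_neq0 ?polyXsubC_eq0 // !size_exp_XsubC; lia.
have sr : (size r + h.*2 <= N.+1)%N.
  by move: sp; rewrite pr size_mul // sw addnS.
(* By its size, [r] contains only monomials of degree [n] with [n + 2h <= N], exactly those tested
   by [pm]. *)
have pr0 : mom a b (p * r) = 0.
  rewrite -[r]coefK poly_def big_distrr /= linear_sum big1 // => i _.
  rewrite -scalerAr linearZ /= pm ?scaler0 //.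
  by rewrite -ltnS (leq_trans _ sr) // ltn_add2r.
suff : (p * r = 0 \/ p * r = 0)%R by case=> /eqP; rewrite mulf_eq0 (negPf p0) (negPf r0).
(* The sign of [((x - a) (x - b)) ^ h] on []a, b[]. *)
pose s : R := (-1) ^+ h.
have : s *: (p * r) = 0 :> {poly R}.
  refine (@mom_pos_eq0 a b _ ab _ _); last by rewrite linearZ /= pr0 scaler0.
  move=> x /andP[ax xb].
  have -> : (s *: (p * r)).[x] = r.[x] ^+ 2 * ((x - a) ^+ h * (b - x) ^+ h).
    rewrite hornerZ hornerM pr hornerM /w hornerM !horner_exp !hornerXsubC.
    rewrite /s -[b - x]opprB [in RHS]exprNn; ring.
  by rewrite mulr_ge0 ?sqr_ge0 // mulr_ge0 // exprn_ge0 // subr_ge0 ltW.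
by move/eqP; rewrite scaler_eq0 signr_eq0 => /eqP; left.
Qed.
End Univariate.

(** * Integrals of continuous functions on boxes *)

Section BorelSets.
Context {R : realType}.
Local Notation M1 := (measurableTypeR R).
Local Notation M2 := (M1 * M1)%type.
Local Notation M3 := (M1 * M1 * M1)%type.

Lemma rat_itv_ball (x e : R) : 0 < e ->
  exists q : rat * rat, (x \in `]ratr q.1, ratr q.2[) /\
    `]ratr q.1, ratr q.2[%classic `<=` ball x e.
Proof.
move=> e0.
have [q1 /[!in_itv]/= /andP[h1 h2]] : exists q : rat, ratr q \in `]x - e, x[.
  by apply: rat_in_itvoo; lra.
have [q2 /[!in_itv]/= /andP[h3 h4]] : exists q : rat, ratr q \in `]x, x + e[.
  by apply: rat_in_itvoo; lra.
exists (q1, q2); split; first by rewrite in_itv /= h2 h3.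
move=> y /=; rewrite in_itv /= => /andP[h5 h6].
by rewrite /ball /= ltr_norml; apply/andP; split; lra.
Qed.

(** An open set is the union of the rational boxes that it contains; replacing the other boxes by
    the empty set makes this a union over a countable type. *)
Lemma open_measurable3 (U : set (R3 R)) : open U -> measurable (U : set M3).
Proof.
move=> oU.
pose box (q : (rat * rat) * (rat * rat) * (rat * rat)) : set M3 :=
  (`]ratr q.1.1.1, ratr q.1.1.2[%classic `*` `]ratr q.1.2.1, ratr q.1.2.2[%classic)
  `*` `]ratr q.2.1, ratr q.2.2[%classic.
pose F q : set M3 := if `[< box q `<=` U >] then box q else set0.
have -> : U = \bigcup_q F q.
  apply/seteqP; split => [x Ux|x [q _]]; last first.
    by rewrite /F; case: asboolP => // /[apply].
  have /nbhs_ballP[e /= e0 eU] : nbhs x U by exact: open_nbhs_nbhs.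
  have [q1 [x1 b1]] := rat_itv_ball x.1.1 e0.
  have [q2 [x2 b2]] := rat_itv_ball x.1.2 e0.
  have [q3 [x3 b3]] := rat_itv_ball x.2 e0.
  exists (q1, q2, q3) => //; rewrite /F; case: asboolP => [_|[]].
    by split => //; split.
  move=> y [[y1 y2] y3]; apply: eU; split; [split|] => /=;
    [exact: b1|exact: b2|exact: b3].
apply: countable_bigcupT_measurable => // q.
rewrite /F; case: ifP => // _.
by apply: measurableX => //; apply: measurableX.
Qed.

Lemma open_measurable2 (U : set (R * R)) : open U -> measurable (U : set M2).
Proof.
move=> oU.
have /(measurable_ysection (0 : M1)) : measurable ((U `*` setT) : set M3).
  apply: open_measurable3; rewrite (_ : _ `*` _ = fst @^-1` U).
    by apply: open_comp => // x _; exact: cvg_fst.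
  by apply/seteqP; split => [x []//|x Ux]; split.
congr (measurable _); apply/seteqP; split => x; rewrite /ysection /= inE; last by [].
by case.
Qed.

Lemma continuous_measurable3 (f : R3 R -> R) : continuous f ->
  measurable_fun (T := M3) setT f.
Proof.
move=> cf; apply: (measurability _ (measurable_realfun.RGenOpens.measurableE R)) => _ [_ [a [b ->] <-]].
rewrite setTI; apply: open_measurable3.
by apply: open_comp => // x _; exact: cf.
Qed.

Lemma continuous_measurable2 (f : R * R -> R) : continuous f ->
  measurable_fun (T := M2) setT f.
Proof.
move=> cf; apply: (measurability _ (measurable_realfun.RGenOpens.measurableE R)) => _ [_ [a [b ->] <-]].
rewrite setTI; apply: open_measurable2.
by apply: open_comp => // x _; exact: cf.
Qed.

End BorelSets.

Section Fubini.
Context d1 d2 (T1 : measurableType d1) (T2 : measurableType d2) (R : realType).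
Variables (m1 : {sigma_finite_measure set T1 -> \bar R}).
Variables (m2 : {sigma_finite_measure set T2 -> \bar R}).
Variables (A : set T1) (B : set T2) (f : T1 * T2 -> R).
Hypotheses (mA : measurable A) (mB : measurable B).
Hypothesis intf : (m1 \x m2)%E.-integrable (A `*` B) (EFin \o f).

Let F := (EFin \o f) \_ (A `*` B).

Let intF : (m1 \x m2)%E.-integrable setT F.
Proof. exact: (iffLR (integrable_mkcond _ (measurableX mA mB)) intf). Qed.

(** [Rintegral] hides a [fine]: integrability of every slice makes the inner integral finite, so
    that [EFin] recovers it. Off [A] both sides are zero. *)
Lemma fubini_F_restrict : (forall x, A x -> m2.-integrable B (fun y => (f (x, y))%:E)) ->
  fubini_F m2 F = (EFin \o fun x => \int[m2]_(y in B) f (x, y)) \_ A.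
Proof.
move=> fx; apply/funext => x; rewrite /fubini_F /patch; case: ifPn => xA.
  rewrite /= /Rintegral fineK; last by apply: integrable_fin_num => //; apply/fx/set_mem.
  rewrite [RHS]integral_mkcond; apply: eq_integral => y _; rewrite /F /patch /=.
  rewrite (_ : ((x, y) \in A `*` B) = (y \in B)) //.
  apply/idP/idP; rewrite !inE => //; first by case.
  by move=> yB; split => //; exact: set_mem.
apply: integral0_eq => y _; rewrite /F /patch; case: ifPn => // /set_mem[/= xA'].
by case/negP: xA; exact: mem_set.
Qed.

Lemma fubini_G_restrict : (forall y, B y -> m1.-integrable A (fun x => (f (x, y))%:E)) ->
  fubini_G m1 F = (EFin \o fun y => \int[m1]_(x in A) f (x, y)) \_ B.
Proof.
move=> fy; apply/funext => y; rewrite /fubini_G /patch; case: ifPn => yB.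
  rewrite /= /Rintegral fineK; last by apply: integrable_fin_num => //; apply/fy/set_mem.
  rewrite [RHS]integral_mkcond; apply: eq_integral => x _; rewrite /F /patch /=.
  rewrite (_ : ((x, y) \in A `*` B) = (x \in A)) //.
  apply/idP/idP; rewrite !inE => //; first by case.
  by move=> xA; split => //; exact: set_mem.
apply: integral0_eq => x _; rewrite /F /patch; case: ifPn => // /set_mem[/= _ yB'].
by case/negP: yB; exact: mem_set.
Qed.

Lemma Rintegral_fubini1 : (forall x, A x -> m2.-integrable B (fun y => (f (x, y))%:E)) ->
  \int[(m1 \x m2)%E]_(z in A `*` B) f z = \int[m1]_(x in A) \int[m2]_(y in B) f (x, y).
Proof.
move=> fx; rewrite /Rintegral; congr fine.
by rewrite integral_mkcond -/F -integral12_prod_meas1 // fubini_F_restrict // -integral_mkcond.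
Qed.

Lemma Rintegral_fubini2 : (forall y, B y -> m1.-integrable A (fun x => (f (x, y))%:E)) ->
  \int[(m1 \x m2)%E]_(z in A `*` B) f z = \int[m2]_(y in B) \int[m1]_(x in A) f (x, y).
Proof.
move=> fy; rewrite /Rintegral; congr fine.
by rewrite integral_mkcond -/F -integral21_prod_meas1 // fubini_G_restrict // -integral_mkcond.
Qed.

End Fubini.

Lemma ord3P (P : 'I_3 -> Prop) : P ax1 -> P ax2 -> P ax3 -> forall i, P i.
Proof.
move=> P1 P2 P3 [[|[|[|//]]] hi].
- by have -> : Ordinal hi = ax1 by exact: val_inj.
- by have -> : Ordinal hi = ax2 by exact: val_inj.
- by have -> : Ordinal hi = ax3 by exact: val_inj.
Qed.

Section Points.
Context {R : realType}.

Lemma coord_mkpt (f : 'I_3 -> R) m : coord (mkpt f) m = f m.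
Proof. by elim/ord3P: m. Qed.

Lemma mkptK (x : R3 R) : mkpt (coord x) = x.
Proof. by case: x => [[]]. Qed.

Lemma eq_pt (x y : R3 R) : (forall m, coord x m = coord y m) -> x = y.
Proof. by move=> xy; rewrite -[x]mkptK -[y]mkptK; congr mkpt; apply/funext. Qed.

Lemma coord_upd (x : R3 R) i t m : coord (upd x i t) m = if m == i then t else coord x m.
Proof. exact: coord_mkpt. Qed.

Lemma continuous_coord m : continuous (fun x : R3 R => coord x m).
Proof.
elim/ord3P: m => x; rewrite /coord /=.
- by apply: (@continuous_comp _ _ _ fst fst); exact: cvg_fst.
- by apply: (@continuous_comp _ _ _ fst snd); [exact: cvg_fst|exact: cvg_snd].
- exact: cvg_snd.
Qed.

Lemma continuous_mkpt (U : topologicalType) (g : 'I_3 -> U -> R) :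
  (forall m, continuous (g m)) -> continuous (fun u => mkpt (g^~ u)).
Proof.
move=> cg u; exact: (cvg_pair (cvg_pair (cg ax1 u) (cg ax2 u)) (cg ax3 u)).
Qed.

Lemma continuous_upd (x : R3 R) i : continuous (upd x i).
Proof.
apply: (@continuous_mkpt _ (fun m t => if m == i then t else coord x m)) => m.
by case: (m == i) => u; [exact: cvg_id|exact: cvg_cst].
Qed.

Definition face_pt (i j l : 'I_3) (c : R) (st : R * R) : R3 R :=
  mkpt (fun m => if m == l then c else if m == i then st.1 else st.2).

Lemma continuous_face_pt i j l c : continuous (face_pt i j l c).
Proof.
apply: (@continuous_mkpt _ (fun m st => if m == l then c else
  if m == i then st.1 else st.2)) => m.
case: (m == l); first by move=> u; exact: cvg_cst.
by case: (m == i) => u; [exact: cvg_fst|exact: cvg_snd].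
Qed.

End Points.

Section BoxIntegrals.
Context {R : realType}.
Local Notation leb := (@lebesgue_measure R).
Implicit Types (a b : R).

Lemma integrable_cont1 (f : R -> R) a b : continuous f ->
  leb.-integrable `[a, b] (EFin \o f).
Proof.
move=> cf; apply: continuous_compact_integrable; first exact: segment_compact.
exact: continuous_subspaceT.
Qed.

Lemma compact_bounded_cont (T : topologicalType) (f : T -> R) (A : set T) :
  compact A -> continuous f -> [bounded f x | x in A].
Proof.
move=> cA cf.
have /compact_bounded[M [_ mrt]] := continuous_compact (continuous_subspaceT cf) cA.
by exists M; split; rewrite ?num_real // => ? ? ? ?; exact: mrt.
Qed.

Lemma lebesgue_itv_lty a b : (leb `[a, b] < +oo)%E.
Proof. by rewrite lebesgue_measure_itv /=; case: ifP => _ //; rewrite -EFinD ltry. Qed.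

Lemma leb2_rect_lty a b c d : (@leb2 R (`[a, b] `*` `[c, d]) < +oo)%E.
Proof.
rewrite /leb2 product_measure1E // lte_mul_pinfty ?lebesgue_itv_lty //.
by rewrite ge0_fin_numE ?lebesgue_itv_lty.
Qed.

Lemma leb3_box_lty a b c d e f : (@leb3 R ((`[a, b] `*` `[c, d]) `*` `[e, f]) < +oo)%E.
Proof.
rewrite /leb3 product_measure1E //; last exact: measurableX.
rewrite lte_mul_pinfty ?lebesgue_itv_lty //.
by rewrite ge0_fin_numE ?leb2_rect_lty.
Qed.

Lemma integrable_cont2 (f : R * R -> R) a b c d : continuous f ->
  (@leb2 R).-integrable (`[a, b] `*` `[c, d]) (EFin \o f).
Proof.
move=> cf; apply: measurable_bounded_integrable.
- exact: measurableX.
- exact: leb2_rect_lty.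
- by apply: measurable_funTS; exact: continuous_measurable2.
- apply: compact_bounded_cont => //.
  by apply: compact_setX; exact: segment_compact.
Qed.

Lemma integrable_cont3 (f : R3 R -> R) a b c d a' b' : continuous f ->
  (@leb3 R).-integrable ((`[a, b] `*` `[c, d]) `*` `[a', b']) (EFin \o f).
Proof.
move=> cf; apply: measurable_bounded_integrable.
- by apply: measurableX => //; exact: measurableX.
- exact: leb3_box_lty.
- by apply: measurable_funTS; exact: continuous_measurable3.
- apply: compact_bounded_cont => //.
  by apply: compact_setX; [apply: compact_setX|]; exact: segment_compact.
Qed.

Lemma continuous_pairl (U V : topologicalType) (f : U * V -> R) x :
  continuous f -> continuous (fun y => f (x, y)).
Proof.
move=> cf y; apply: (@continuous_comp _ _ _ (fun y => (x, y)) f); last exact: cf.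
by apply: cvg_pair; [exact: cvg_cst|exact: cvg_id].
Qed.

Lemma continuous_pairr (U V : topologicalType) (f : U * V -> R) y :
  continuous f -> continuous (fun x => f (x, y)).
Proof.
move=> cf x; apply: (@continuous_comp _ _ _ (fun x => (x, y)) f); last exact: cf.
by apply: cvg_pair; [exact: cvg_id|exact: cvg_cst].
Qed.

Lemma Rintegral_rect1 (f : R * R -> R) a b c d : continuous f ->
  \int[leb2]_(z in `[a, b] `*` `[c, d]) f z =
  \int[leb]_(x in `[a, b]) \int[leb]_(y in `[c, d]) f (x, y).
Proof.
move=> cf; apply: Rintegral_fubini1 => //; first exact: integrable_cont2.
by move=> x _; apply: integrable_cont1; exact: continuous_pairl.
Qed.

Lemma Rintegral_rect2 (f : R * R -> R) a b c d : continuous f ->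
  \int[leb2]_(z in `[a, b] `*` `[c, d]) f z =
  \int[leb]_(y in `[c, d]) \int[leb]_(x in `[a, b]) f (x, y).
Proof.
move=> cf; apply: Rintegral_fubini2 => //; first exact: integrable_cont2.
by move=> x _; apply: (@integrable_cont1 (fun y => f (y, x))); exact: continuous_pairr.
Qed.

Lemma Rintegral_box1 (f : R3 R -> R) a b c d a' b' : continuous f ->
  \int[leb3]_(x in (`[a, b] `*` `[c, d]) `*` `[a', b']) f x =
  \int[leb2]_(st in `[a, b] `*` `[c, d]) \int[leb]_(z in `[a', b']) f (st, z).
Proof.
move=> cf; apply: Rintegral_fubini1 => //; first exact: measurableX.
  exact: integrable_cont3.
by move=> x _; apply: integrable_cont1; exact: continuous_pairl.
Qed.

Lemma Rintegral_box2 (f : R3 R -> R) a b c d a' b' : continuous f ->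
  \int[leb3]_(x in (`[a, b] `*` `[c, d]) `*` `[a', b']) f x =
  \int[leb]_(z in `[a', b']) \int[leb2]_(st in `[a, b] `*` `[c, d]) f (st, z).
Proof.
move=> cf; apply: Rintegral_fubini2 => //; first exact: measurableX.
  exact: integrable_cont3.
move=> x _; apply: (@integrable_cont2 (fun y => f (y, x))); exact: continuous_pairr.
Qed.

Lemma box_setE (T : @box R) : box_set T =
  (`[coord T.1 ax1, coord T.2 ax1] `*` `[coord T.1 ax2, coord T.2 ax2])
  `*` `[coord T.1 ax3, coord T.2 ax3].
Proof.
apply/seteqP; split => x /=.
  by move=> Tx; split; [split|] => /=; rewrite in_itv /=; [exact: (Tx ax1)|exact: (Tx ax2)|exact: (Tx ax3)].
by rewrite !in_itv /= => -[[h1 h2] h3]; elim/ord3P.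
Qed.

(** The two directions other than [l], in increasing order, which is the order of the factors in the
    iterated integrals. *)
Definition other1 (l : 'I_3) := if l == ax1 then ax2 else ax1.
Definition other2 (l : 'I_3) := if l == ax3 then ax2 else ax3.

Definition face_int (T : @box R) (l : 'I_3) (c : R) (g : R3 R -> R) : R :=
  \int[leb2]_(st in `[coord T.1 (other1 l), coord T.2 (other1 l)] `*`
                    `[coord T.1 (other2 l), coord T.2 (other2 l)])
     g (face_pt (other1 l) (other2 l) l c st).

Lemma FTC_segment (F f : R -> R) a b : a < b -> continuous f ->
  (forall x : R, is_derive x 1 F (f x)) ->
  \int[leb]_(x in `[a, b]) f x = F b - F a.
Proof.
move=> ab cf dF.
have cF : continuous F.
  by move=> x; apply/differentiable_continuous/derivable1_diffP; have [] := dF x.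
rewrite /Rintegral (continuous_FTC2 ab _ _ (F := F)) //.
- exact: continuous_subspaceT.
- split; first by move=> x _; have [] := dF x.
  + exact/cvg_at_right_filter/cF.
  + exact/cvg_at_left_filter/cF.
- by move=> x _; rewrite derive1E; exact: derive_val.
Qed.

(** Fubini with [x_l] as the innermost variable, then the fundamental theorem of calculus on each
    line parallel to the [x_l]-axis. *)
Lemma box_divergence (T : @box R) (l : 'I_3) (g dg : R3 R -> R) : is_cell T ->
  continuous g -> continuous dg ->
  (forall x (t : R), is_derive t 1 (fun t => g (upd x l t)) (dg (upd x l t))) ->
  \int[leb3]_(x in box_set T) dg x =
  face_int T l (coord T.2 l) g - face_int T l (coord T.1 l) g.
Proof.
move=> cT cg cdg dgE.
have cgf c : continuous (fun st => g (face_pt (other1 l) (other2 l) l c st)).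
  move=> st; apply: (@continuous_comp _ _ _ (face_pt _ _ _ c) g); last exact: cg.
  exact: continuous_face_pt.
rewrite /face_int -RintegralB; [|by apply: measurableX| |]; try exact: integrable_cont2.
have FTCl x : \int[leb]_(t in `[coord T.1 l, coord T.2 l]) dg (upd x l t) =
    g (upd x l (coord T.2 l)) - g (upd x l (coord T.1 l)).
  apply: (@FTC_segment (fun t => g (upd x l t)) (fun t => dg (upd x l t))).
  - exact: cT.
  - move=> t; apply: (@continuous_comp _ _ _ (upd x l) dg); [exact: continuous_upd|exact: cdg].
rewrite box_setE.
(* The order of integration depends on [l]. The zero in the points given to [FTCl] stands in
   direction [l], where [upd] overwrites it. *)
elim/ord3P: l dgE cgf FTCl => dgE cgf FTCl.
- rewrite Rintegral_box2 // Rintegral_rect2; last first.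
    by move=> st; apply: cvgB; exact: cgf.
  apply: eq_Rintegral => z _; rewrite Rintegral_rect2; last exact: continuous_pairr.
  by apply: eq_Rintegral => y _; exact: (FTCl (0, y, z)).
- rewrite Rintegral_box2 // Rintegral_rect2; last first.
    by move=> st; apply: cvgB; exact: cgf.
  apply: eq_Rintegral => z _; rewrite Rintegral_rect1; last exact: continuous_pairr.
  by apply: eq_Rintegral => y _; exact: (FTCl (y, 0, z)).
- rewrite Rintegral_box1 //.
  by apply: eq_Rintegral => st _; move: (FTCl (st, 0)); case: st.
Qed.

End BoxIntegrals.

(** * Polynomial functions of three variables *)

Section Directional.
Context {R : realType}.

Lemma upd_shift (x : R3 R) i h : h *: unitv i + x = upd x i (h + coord x i).
Proof.
apply: eq_pt => m; rewrite coord_upd.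
have -> : coord (h *: unitv i + x) m = h * (m == i)%:R + coord x m.
  by elim/ord3P: m.
by case: eqP => [->|_]; rewrite ?mulr1 ?mulr0 ?add0r.
Qed.

Lemma upd_coord (x : R3 R) i : upd x i (coord x i) = x.
Proof. by apply: eq_pt => m; rewrite coord_upd; case: eqP => [->|]. Qed.

Lemma upd_upd (x : R3 R) i s t : upd (upd x i s) i t = upd x i t.
Proof. by apply: eq_pt => m; rewrite !coord_upd; case: eqP. Qed.

(** The two difference quotients agree as functions of [h], so both the value and the existence of a
    directional derivative reduce to one variable. *)
Let difference_quotientE (f : R3 R -> R) (x : R3 R) i :
  (fun h => h^-1 *: ((f \o shift x) (h *: unitv i) - f x)) =
  (fun h => h^-1 *: (((fun t => f (upd x i t)) \o shift (coord x i)) (h *: 1)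
              - (fun t => f (upd x i t)) (coord x i))).
Proof. by apply/funext => h /=; rewrite upd_shift upd_coord /GRing.scale /= mulr1. Qed.

Lemma partialE i (f : R3 R -> R) x :
  partial i f x = 'D_1 (fun t => f (upd x i t)) (coord x i).
Proof. by rewrite /partial /derive difference_quotientE. Qed.

Lemma derivable_unitv i (f : R3 R -> R) x : derivable f x (unitv i) <->
  derivable (fun t => f (upd x i t)) (coord x i) 1.
Proof. by rewrite /derivable difference_quotientE. Qed.

Lemma is_derive_upd i (f : R3 R -> R) : (forall x, derivable f x (unitv i)) ->
  forall x (t : R), is_derive t 1 (fun t => f (upd x i t)) (partial i f (upd x i t)).
Proof.
move=> df x t.
have gE : (fun s => f (upd (upd x i t) i s)) = (fun s => f (upd x i s)).
  by apply/funext => s; rewrite upd_upd.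
have ct : coord (upd x i t) i = t by rewrite coord_upd eqxx.
apply: DeriveDef; first by have /derivable_unitv := df (upd x i t); rewrite gE ct.
by rewrite partialE gE ct.
Qed.

End Directional.

Section Polynomials.
Context {R : realType}.
Implicit Types (e : 'I_3 -> nat) (x : R3 R).

Lemma prod_ord3 (F : 'I_3 -> R) : \prod_m F m = F ax1 * F ax2 * F ax3.
Proof.
rewrite !big_ord_recl big_ord0 mulr1 mulrA.
by congr (F _ * F _ * F _); exact: val_inj.
Qed.

Definition mono e x : R := \prod_m coord x m ^+ e m.

(** Exponents may repeat: derivatives, products by monomials and integrals in one variable then keep
    the index type and change only [c] and [e]. *)
Definition psum n (c : 'I_n -> R) (e : 'I_n -> 'I_3 -> nat) x :=
  \sum_r c r * mono (e r) x.

Definition mono_rest e x i := \prod_(m | m != i) coord x m ^+ e m.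

Lemma mono_upd e x i t : mono e (upd x i t) = mono_rest e x i * t ^+ e i.
Proof.
rewrite /mono (bigD1 i) //= coord_upd eqxx mulrC; congr (_ * _).
by apply: eq_bigr => m /negPf mi; rewrite coord_upd mi.
Qed.

Definition slice n (c : 'I_n -> R) (e : 'I_n -> 'I_3 -> nat) x i : {poly R} :=
  \sum_r (c r * mono_rest (e r) x i) *: 'X^(e r i).

Lemma psum_upd n (c : 'I_n -> R) (e : 'I_n -> 'I_3 -> nat) x i t :
  psum c e (upd x i t) = (slice c e x i).[t].
Proof.
rewrite /slice horner_sum; apply: eq_bigr => r _.
by rewrite mono_upd hornerZ hornerXn mulrA.
Qed.

Lemma continuous_mono e : continuous (mono e).
Proof.
have -> : mono e = fun x => coord x ax1 ^+ e ax1 * (coord x ax2 ^+ e ax2 * coord x ax3 ^+ e ax3).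
  by apply/funext => x; rewrite /mono prod_ord3 mulrA.
have cX m k : continuous (fun x : R3 R => coord x m ^+ k).
  move=> x; apply: (@continuous_comp _ _ _ (coord^~ m) (fun y => y ^+ k)).
    exact: continuous_coord.
  exact: exprn_continuous.
by move=> x; apply: cvgM; [exact: cX|apply: cvgM; exact: cX].
Qed.

Lemma continuous_bigsum (T : topologicalType) I (s : seq I) (F : I -> T -> R) :
  (forall i, continuous (F i)) -> continuous (fun y => \sum_(i <- s) F i y).
Proof.
move=> cF; elim: s => [|i s IH] x.
  under eq_fun do rewrite big_nil; exact: cvg_cst.
under eq_fun do rewrite big_cons.
by apply: cvgD; [exact: cF|exact: IH].
Qed.

Lemma continuous_psum n (c : 'I_n -> R) (e : 'I_n -> 'I_3 -> nat) : continuous (psum c e).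
Proof.
apply: continuous_bigsum => r x; apply: cvgM; first exact: cvg_cst.
exact: continuous_mono.
Qed.

(** The subtraction is truncated: where [e r i = 0] the exponent stays [0], and the coefficient
    [c r *+ 0] removes the term. *)
Lemma is_derive_psum n (c : 'I_n -> R) (e : 'I_n -> 'I_3 -> nat) i x (t : R) :
  is_derive t 1 (fun t => psum c e (upd x i t))
    (psum (fun r => c r *+ e r i) (fun r m => (e r m - (m == i))%N) (upd x i t)).
Proof.
rewrite (_ : (fun _ => _) = horner (slice c e x i)); last first.
  by apply/funext => s; rewrite psum_upd.
apply: DeriveDef; first exact: derivable_horner.
rewrite -derive1E -derivE psum_upd /slice raddf_sum !horner_sum.
apply: eq_bigr => r _; rewrite -[X in X.[_]]/(deriv _) derivZ derivXn !hornerZ hornerMn !hornerXn.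
have -> : mono_rest (fun m => (e r m - (m == i))%N) x i = mono_rest (e r) x i.
  by apply: eq_bigr => m /negPf ->; rewrite subn0.
by rewrite eqxx subn1 mulrnAr !mulrnAl.
Qed.

Lemma partial_psum n (c : 'I_n -> R) (e : 'I_n -> 'I_3 -> nat) i :
  partial i (psum c e) =
  psum (fun r => c r *+ e r i) (fun r m => (e r m - (m == i))%N).
Proof.
apply/funext => x; rewrite partialE.
by have /@derive_val -> := is_derive_psum c e i x (coord x i); rewrite upd_coord.
Qed.

(** Each direction is derived at most once, as in the degrees of freedom, hence a plain factor
    [e r m] for each listed direction. *)
Lemma partials_psum n (c : 'I_n -> R) (e : 'I_n -> 'I_3 -> nat) a : uniq a ->
  partials a (psum c e) =
  psum (fun r => c r * \prod_(m <- a) (e r m)%:R) (fun r m => (e r m - (m \in a))%N).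
Proof.
elim: a => [_|i a IH /= /andP[ia ua]].
  apply/funext => x; apply: eq_bigr => r _; rewrite big_nil mulr1.
  by congr (_ * mono _ _); apply/funext => m; rewrite in_nil subn0.
rewrite IH // partial_psum; apply/funext => x; apply: eq_bigr => r _.
rewrite (negPf ia) subn0 big_cons -[_ *+ _]mulr_natr; congr (_ * mono _ _).
  by rewrite -mulrA [X in _ * X]mulrC.
apply/funext => m; rewrite in_cons -subnDA; congr (_ - _)%N.
by case: eqP => [->|_]; rewrite ?(negPf ia) ?addn0.
Qed.

(* The integral of [t ^ n] over [[a, b]]. *)
Definition intXn (a b : R) n := (b ^+ n.+1 - a ^+ n.+1) / n.+1%:R.

Lemma mom_sum a b n (c : 'I_n -> R) (e : 'I_n -> nat) :
  mom a b (\sum_r c r *: 'X^(e r)) = \sum_r c r * intXn a b (e r).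
Proof. by rewrite linear_sum; apply: eq_bigr => r _; rewrite linearZ /= momXn. Qed.

Lemma Rintegral_horner a b (p : {poly R}) : a < b ->
  \int[lebesgue_measure]_(t in `[a, b]) p.[t] = mom a b p.
Proof.
move=> ab; apply: (@FTC_segment _ (horner (prim p))) => //.
  exact: continuous_horner.
move=> x; apply: DeriveDef; first exact: derivable_horner.
by rewrite -derive1E -derivE deriv_prim.
Qed.

Lemma mulr_psum_mono n (c : 'I_n -> R) (e : 'I_n -> 'I_3 -> nat) q x :
  psum c e x * mono q x = psum c (fun r m => (e r m + q m)%N) x.
Proof.
rewrite big_distrl /=; apply: eq_bigr => r _; rewrite -mulrA; congr (_ * _).
by rewrite -big_split; apply: eq_bigr => m _; rewrite exprD.
Qed.

Lemma mono_erase e x i : mono (fun m => if m == i then 0%N else e m) x = mono_rest e x i.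
Proof.
rewrite /mono (bigD1 i) //= eqxx expr0 mul1r.
by apply: eq_bigr => m /negPf ->.
Qed.

(** The integrated variable stays formally present with exponent [0], so the result is again a
    [psum] and can be integrated in another direction. *)
Lemma Rintegral_psum_upd n (c : 'I_n -> R) (e : 'I_n -> 'I_3 -> nat) x i a b : a < b ->
  \int[lebesgue_measure]_(t in `[a, b]) psum c e (upd x i t) =
  psum (fun r => c r * intXn a b (e r i)) (fun r m => if m == i then 0%N else e r m) x.
Proof.
move=> ab; under eq_Rintegral do rewrite psum_upd.
rewrite Rintegral_horner // mom_sum; apply: eq_bigr => r _.
by rewrite mono_erase mulrAC.
Qed.

Lemma Rintegral_psum_upd2 n (c : 'I_n -> R) (e : 'I_n -> 'I_3 -> nat) x i j a b a' b' :
  a < b -> a' < b' -> i != j ->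
  \int[leb2]_(st in `[a, b] `*` `[a', b']) psum c e (upd (upd x i st.1) j st.2) =
  psum (fun r => c r * (intXn a b (e r i) * intXn a' b' (e r j)))
    (fun r m => if (m == i) || (m == j) then 0%N else e r m) x.
Proof.
move=> ab ab' ij; rewrite (Rintegral_rect1 (f := fun st => psum c e (upd (upd x i st.1) j st.2))).
  rewrite /=; under eq_Rintegral do rewrite Rintegral_psum_upd //.
  rewrite Rintegral_psum_upd //; apply: eq_bigr => r _; rewrite (negPf ij).
  congr (_ * _); first by rewrite -mulrA [X in _ * X]mulrC.
  by congr mono; apply/funext => m; case: (m == i).
move=> st; apply: (@continuous_comp _ _ _
  (fun st : R * R => upd (upd x i st.1) j st.2) (psum c e)); last exact: continuous_psum.
apply: (@continuous_mkpt _ _ (fun m (st : R * R) => if m == j then st.2 else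
   if m == i then st.1 else coord x m)) => m.
case: (m == j) => u; first exact: cvg_snd.
by case: (m == i); [exact: cvg_fst|exact: cvg_cst].
Qed.

Lemma Rintegral_psum_box n (c : 'I_n -> R) (e : 'I_n -> 'I_3 -> nat) (T : @box R) :
  is_cell T ->
  \int[leb3]_(x in box_set T) psum c e x =
  \sum_r c r * \prod_m intXn (coord T.1 m) (coord T.2 m) (e r m).
Proof.
move=> cT; rewrite box_setE Rintegral_box1; last exact: continuous_psum.
transitivity (\int[leb2]_(st in `[coord T.1 ax1, coord T.2 ax1] `*` `[coord T.1 ax2, coord T.2 ax2])
  psum (fun r => c r * intXn (coord T.1 ax3) (coord T.2 ax3) (e r ax3))
    (fun r m => if m == ax3 then 0%N else e r m) (upd (upd 0 ax1 st.1) ax2 st.2)).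
  apply: eq_Rintegral => -[s t] _.
  exact: (Rintegral_psum_upd c e (s, t, 0) ax3 (cT ax3)).
rewrite Rintegral_psum_upd2 //; apply: eq_bigr => r _.
have -> : mono (fun m => if (m == ax1) || (m == ax2) then 0%N else
   if m == ax3 then 0%N else e r m) (0 : R3 R) = 1.
  by apply: big1; apply: ord3P => _ /=; rewrite expr0.
by rewrite mulr1 prod_ord3 -mulrA; congr (_ * _); rewrite mulrC.
Qed.

(** One formula serves vertices, edges, faces and cells: a free direction contributes an integral, a
    frozen one the value at the lower corner. *)
Lemma moment_psum n (c : 'I_n -> R) (e : 'I_n -> 'I_3 -> nat) q (A : seq 'I_3) (G : @box R) :
  uniq A -> (forall m, m \in A -> coord G.1 m < coord G.2 m) ->
  moment A G (psum c e) (mono q) =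
  \sum_r c r * \prod_m (if m \in A then intXn (coord G.1 m) (coord G.2 m) (e r m + q m)
                         else coord G.1 m ^+ (e r m + q m)).
Proof.
case: A => [|i [|j [|l A]]] uA GA.
- by rewrite /moment mulr_psum_mono.
- rewrite /moment /edge_moment.
  under eq_Rintegral do rewrite mulr_psum_mono.
  rewrite Rintegral_psum_upd ?GA ?mem_head //; apply: eq_bigr => r _.
  rewrite mono_erase -mulrA; congr (_ * _); rewrite [RHS](bigD1 i) //= mem_head.
  by congr (_ * _); apply: eq_bigr => m /negPf mi; rewrite inE mi.
- rewrite /moment /face_moment /=.
  under eq_Rintegral do rewrite mulr_psum_mono.
  move: uA; rewrite /= inE andbT => ij.
  rewrite Rintegral_psum_upd2 ?GA ?inE ?eqxx ?orbT //; apply: eq_bigr => r _.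
  rewrite -mulrA; congr (_ * _); rewrite [RHS](bigD1 i) //= mem_head -mulrA; congr (_ * _).
  rewrite [RHS](bigD1 j) 1?eq_sym //= !inE eqxx orbT; congr (_ * _).
  rewrite /mono (bigD1 i) // (bigD1 j) 1?eq_sym //= !eqxx orbT !expr0 !mul1r.
  by apply: eq_bigr => m /andP[/negPf mi /negPf mj]; rewrite !inE mi mj.
(* Three distinct axes are all of them, so this branch is the integral over the whole cell. *)
- have inA m : m \in [:: i, j, l & A].
    have := @uniq_min_size _ [:: i; j; l] (enum 'I_3).
    rewrite size_enum_ord => /(_ _ _ (leqnn _)) h.
    have [] := h.
    + by move: uA; rewrite /= !inE !negb_or; case/and4P=> /and3P[-> -> _] /andP[-> _].
    + by move=> ? _; rewrite mem_enum.
    + move=> _ /(_ m); rewrite mem_enum => h'.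
      have : m \in [:: i; j; l] by rewrite h'.
      by rewrite !inE => /or3P[] ->; rewrite ?orbT.
  rewrite /moment /cell_moment.
  under eq_Rintegral do rewrite mulr_psum_mono.
  rewrite Rintegral_psum_box; last by move=> m; exact: GA.
  by apply: eq_bigr => r _; congr (_ * _); apply: eq_bigr => m _; rewrite inA.
Qed.

Lemma dof_psum n (c : 'I_n -> R) (e : 'I_n -> 'I_3 -> nat) q (s : dofspec) (G : @box R) u :
  entry u (row_ s) (col_ s) = psum c e ->
  uniq (der s) -> uniq (support_axes s) ->
  (forall m, m \in support_axes s -> coord G.1 m < coord G.2 m) ->
  dof s G (mono q) u = \sum_r c r * \prod_m
    ((if m \in der s then (e r m)%:R else 1) *
     (if m \in support_axes s
      then intXn (coord G.1 m) (coord G.2 m) (e r m - (m \in der s) + q m)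
      else coord G.1 m ^+ (e r m - (m \in der s) + q m))).
Proof.
move=> ue ud uA GA; rewrite /dof ue partials_psum // moment_psum //.
apply: eq_bigr => r _; rewrite -mulrA; congr (_ * _).
by rewrite [RHS]big_split /= big_uniq //= -[in RHS]big_mkcond.
Qed.

End Polynomials.

Section PolynomialFunctions.
Context {R : realType}.

Definition polyfun (f : R3 R -> R) :=
  exists n (c : 'I_n -> R) (e : 'I_n -> 'I_3 -> nat), f = psum c e.

Lemma polyfun_continuous f : polyfun f -> continuous f.
Proof. by move=> [n [c [e ->]]]; exact: continuous_psum. Qed.

Lemma polyfun_partial i f : polyfun f -> polyfun (partial i f).
Proof. by move=> [n [c [e ->]]]; rewrite partial_psum; do 3 eexists. Qed.

Lemma polyfun_partials a f : polyfun f -> polyfun (partials a f).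
Proof. by elim: a => //= i a IH /IH; exact: polyfun_partial. Qed.

Lemma polyfun_derivable i f x : polyfun f -> derivable f x (unitv i).
Proof.
move=> [n [c [e ->]]]; apply/derivable_unitv.
by have [] := is_derive_psum c e i x (coord x i).
Qed.

Lemma partials_linear a l f g : polyfun f -> polyfun g ->
  partials l (a *: f + g) = a *: partials l f + partials l g.
Proof.
move=> pf pg; elim: l => //= i l ->; apply/funext => x; rewrite /partial.
have df := @polyfun_derivable i _ x (polyfun_partials l pf).
have dg := @polyfun_derivable i _ x (polyfun_partials l pg).
by rewrite deriveD ?deriveZ //; exact: derivableZ.
Qed.

Lemma RintegralDZ d (T : measurableType d) (mu : {measure set T -> \bar R})
    (A : set T) (a : R) (f g : T -> R) : measurable A ->
  mu.-integrable A (EFin \o f) -> mu.-integrable A (EFin \o g) ->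
  \int[mu]_(x in A) (a * f x + g x) = a * \int[mu]_(x in A) f x + \int[mu]_(x in A) g x.
Proof.
move=> mA fi gi; rewrite -RintegralZl // -RintegralD //.
by have := integrableZl mA a fi.
Qed.

(** Once the test function is absorbed, the moment is symmetric in [f] and [p], and linearity in
    either argument is linearity of the integral. *)
Lemma moment_mulE A (G : @box R) f p :
  moment A G f p = moment A G (f \* p) (fun=> 1).
Proof.
by case: A => [|i [|j [|l A]]]; rewrite /moment /edge_moment /face_moment /cell_moment
  ?mulr1 //; apply: eq_Rintegral => x _; rewrite mulr1.
Qed.

Lemma moment_linear A (G : @box R) a (f g : R3 R -> R) : continuous f -> continuous g ->
  moment A G (a *: f + g) (fun=> 1) = a * moment A G f (fun=> 1) + moment A G g (fun=> 1).
Proof.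
move=> cf cg; case: A => [|i [|j [|l A]]]; rewrite /moment /edge_moment /face_moment /cell_moment.
- by rewrite !mulr1.
- rewrite -RintegralDZ //.
  + by apply: eq_Rintegral => t _; rewrite !mulr1.
  + apply: integrable_cont1 => t; under eq_fun do rewrite mulr1.
    by apply: (@continuous_comp _ _ _ (upd G.1 i) f); [exact: continuous_upd|exact: cf].
  + apply: integrable_cont1 => t; under eq_fun do rewrite mulr1.
    by apply: (@continuous_comp _ _ _ (upd G.1 i) g); [exact: continuous_upd|exact: cg].
- have cu : continuous (fun st : R * R => upd (upd G.1 i st.1) j st.2).
    apply: (@continuous_mkpt _ _ (fun m (st : R * R) => if m == j then st.2 else
      coord (upd G.1 i st.1) m)) => m.
    case: (m == j) => u; first exact: cvg_snd.
    under eq_fun do rewrite coord_upd.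
    by case: (m == i); [exact: cvg_fst|exact: cvg_cst].
  have chu (h : R3 R -> R) : continuous h ->
      continuous (fun st : R * R => h (upd (upd G.1 i st.1) j st.2) * (1 : R)).
    move=> ch st; apply: cvgM; last exact: cvg_cst.
    apply: (@continuous_comp _ _ _ (fun st : R * R => upd (upd G.1 i st.1) j st.2) h).
      exact: cu.
    exact: ch.
  rewrite -RintegralDZ //=.
  + by apply: eq_Rintegral => t _; rewrite !mulr1.
  + exact: measurableX.
  + exact/integrable_cont2/chu.
  + exact/integrable_cont2/chu.
- rewrite box_setE -RintegralDZ //=.
  + by apply: eq_Rintegral => t _; rewrite !mulr1.
  + by apply: measurableX => //; exact: measurableX.
  + by apply: integrable_cont3 => x; apply: cvgM; [exact: cf|exact: cvg_cst].
  + by apply: integrable_cont3 => x; apply: cvgM; [exact: cg|exact: cvg_cst].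
Qed.

Lemma moment_linearl A (G : @box R) a f g p : continuous f -> continuous g -> continuous p ->
  moment A G (a *: f + g) p = a * moment A G f p + moment A G g p.
Proof.
move=> cf cg cp; rewrite moment_mulE [in X in a * X]moment_mulE [X in _ = _ + X]moment_mulE.
have cfp : continuous (f \* p) by move=> x; apply: cvgM; [exact: cf|exact: cp].
have cgp : continuous (g \* p) by move=> x; apply: cvgM; [exact: cg|exact: cp].
rewrite -moment_linear //.
congr moment; apply/funext => x; transitivity ((a * f x + g x) * p x); first by [].
by rewrite mulrDl -mulrA.
Qed.

Lemma moment_linearr A (G : @box R) a f p q : continuous f -> continuous p -> continuous q ->
  moment A G f (a *: p + q) = a * moment A G f p + moment A G f q.
Proof.
move=> cf cp cq; have mC u v : moment A G u v = moment A G v u.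
  by rewrite moment_mulE [RHS]moment_mulE; congr moment; apply/funext => x; rewrite /= mulrC.
by rewrite mC moment_linearl // mC [moment A G q f]mC.
Qed.

Lemma dof_linearl s (G : @box R) p a (u v : field3) :
  polyfun (entry u (row_ s) (col_ s)) -> polyfun (entry v (row_ s) (col_ s)) ->
  continuous p -> dof s G p (a *: u + v) = a * dof s G p u + dof s G p v.
Proof.
move=> pu pv cp; rewrite /dof.
have -> : entry (a *: u + v) (row_ s) (col_ s) =
    a *: entry u (row_ s) (col_ s) + entry v (row_ s) (col_ s).
  apply/funext => x; transitivity ((a *: u x + v x) (row_ s) (col_ s)); first by [].
  by rewrite !mxE.
rewrite partials_linear // moment_linearl //; exact/polyfun_continuous/polyfun_partials.
Qed.

Lemma dof_linearr s (G : @box R) p q a (u : field3) :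
  polyfun (entry u (row_ s) (col_ s)) -> continuous p -> continuous q ->
  dof s G (a *: p + q) u = a * dof s G p u + dof s G q u.
Proof.
move=> pu cp cq; rewrite /dof moment_linearr //.
exact/polyfun_continuous/polyfun_partials.
Qed.

End PolynomialFunctions.

(** * The degrees of freedom as tensor products *)

Section Conditions.
Context {R : realType}.

(* The order of the Hermite conditions imposed on the entry [(a, b)] at the two
   ends of an interval in direction [m]: the degree in [x_m] is [k - 2] plus
   this order, and the moments are of degree at most [k - 2] minus it. *)
Definition hord (a b m : 'I_3) : nat := ((a != m) + (b != m))%N.

Lemma hord_le2 a b m : (hord a b m <= 2)%N.
Proof. by rewrite /hord; case: eqP; case: eqP. Qed.

(* A univariate condition in one direction: the derivative of order [t] at the
   lower ([false]) or upper ([true]) end when it is [(Some t, _, _)], and the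
   moment against [x ^ q] when it is [(None, _, q)]. *)
Definition cond := (option nat * bool * nat)%type.

(** For a moment this means [x.2 <= k - 2 - hord a b m], written without truncated subtraction: at
    [k = 3] and order two no moment is allowed. *)
Definition valid_cond (k : nat) (a b m : 'I_3) (x : cond) : Prop :=
  if x.1.1 is Some t then (t < hord a b m)%N else (x.2 + hord a b m + 2 <= k)%N.

(* The value of the condition [x] at the monomial of degree [n]. *)
Definition cond_val (T : @box R) (m : 'I_3) (x : cond) (n : nat) : R :=
  if x.1.1 is Some t
  then (n ^_ t)%:R * coord (if x.1.2 then T.2 else T.1) m ^+ (n - t)
  else intXn (coord T.1 m) (coord T.2 m) (n + x.2).

Definition conds_entity (x : 'I_3 -> cond) : {ffun 'I_3 -> option bool} :=
  [ffun m => if (x m).1.1 is Some _ then Some (x m).1.2 else None].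

Definition conds_mono (x : 'I_3 -> cond) : R3 R -> R :=
  mono (fun m => if (x m).1.1 is None then (x m).2 else 0%N).

Lemma derivnXn_horner (c : R) n t : (('X^n)^`(t)).[c] = (n ^_ t)%:R * c ^+ (n - t).
Proof. by rewrite derivnXn hornerMn hornerXn mulr_natl. Qed.

(** One direction of the tensor argument: [d] stands for the coefficients multiplied by the factors
    from the two other directions. *)
Lemma cond_val_unisolvent (k : nat) (a b m : 'I_3) (T : @box R) n (d : 'I_n -> R)
    (e : 'I_n -> nat) (y : R) : is_cell T -> (2 <= k)%N ->
  (forall r, (e r <= k - 2 + hord a b m)%N) ->
  (forall x, valid_cond k a b m x -> \sum_r d r * cond_val T m x (e r) = 0) ->
  \sum_r d r * y ^+ e r = 0.
Proof.
move=> cT k2 eb dx; pose p : {poly R} := \sum_r d r *: 'X^(e r).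
have pE t c : (p^`(t)).[c] = \sum_r d r * ((e r ^_ t)%:R * c ^+ (e r - t)).
  rewrite /p raddf_sum horner_sum; apply: eq_bigr => r _.
  by rewrite /= derivnZ hornerZ derivnXn_horner.
suff p0 : p = 0.
  rewrite -[RHS](horner0 y) -p0 horner_sum.
  by apply: eq_bigr => r _; rewrite hornerZ hornerXn.
apply: (@hermite_moments_eq0 _ _ _ (hord a b m) (k - 2 + hord a b m) _ (cT m)).
- exact: hord_le2.
- apply/(leq_trans (size_sum _ _ _))/bigmax_leqP => r _.
  by rewrite (leq_trans (size_scale_leq _ _)) // size_polyXn ltnS.
- by move=> t th; rewrite pE; exact: (dx (Some t, false, 0%N)).
- by move=> t th; rewrite pE; exact: (dx (Some t, true, 0%N)).
(* With [h = hord a b m], the bound [q + 2h <= k - 2 + h] is the validity condition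
   [q + h + 2 <= k]. *)
- move=> q qk; rewrite -[RHS](dx (None, true, q)); last by rewrite /valid_cond /=; lia.
  rewrite /p big_distrl /= linear_sum; apply: eq_bigr => r _.
  by rewrite -scalerAl -exprD linearZ /= momXn.
Qed.

(** With two factors fixed, the third is a univariate problem whose coefficients are [c r] times the
    fixed factors, so [lam] is exchanged for [out] in one direction at a time. The families are
    abstract because three of them are plugged in: for unisolvence, for the trace on a face, and for
    the independence of monomials. *)
Lemma tensor_eq0 (D : Type) (V : 'I_3 -> D -> Prop) (lam : 'I_3 -> D -> nat -> R)
    (out : 'I_3 -> nat -> R) n (c : 'I_n -> R) (e : 'I_n -> 'I_3 -> nat) :
  (forall m (d : 'I_n -> R), (forall x, V m x -> \sum_r d r * lam m x (e r m) = 0) ->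
     \sum_r d r * out m (e r m) = 0) ->
  (forall x : 'I_3 -> D, (forall m, V m (x m)) ->
     \sum_r c r * \prod_m lam m (x m) (e r m) = 0) ->
  \sum_r c r * \prod_m out m (e r m) = 0.
Proof.
move=> dim1 dim3.
under eq_bigr do rewrite prod_ord3 mulrA.
apply: (dim1) => x3 V3.
under eq_bigr do rewrite mulrA mulrAC.
apply: (dim1) => x2 V2.
under eq_bigr do rewrite mulrAC (mulrAC (c _)) mulrAC.
apply: (dim1) => x1 V1.
pose x m := if m == ax1 then x1 else if m == ax2 then x2 else x3.
rewrite -[RHS](dim3 x); last by elim/ord3P.
by apply: eq_bigr => r _; rewrite prod_ord3 /x /=; ring.
Qed.

End Conditions.

(** * Matching the listed degrees of freedom with tensor products *)

Section Specs.

(** [sh] is the shape of a triple of conditions: [Some t] for a derivative of order [t] at an end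
    point, [None] for a moment. The last clause makes the test space admit exactly the moments
    allowed by [valid_cond]. *)
Definition fits (k : nat) (a b : 'I_3) (sh : 'I_3 -> option nat) (s : dofspec) : Prop :=
  [/\ row_ s = a, col_ s = b, uniq (der s) /\ uniq (support_axes s),
      (forall m, (m \in der s) = (sh m == Some 1%N)) /\
      (forall m, (m \in support_axes s) = (sh m == None)) &
      forall m, sh m = None -> bound (test s) m = k%:Z - 2 - (hord a b m)%:Z].

Lemma ord3_cases (i j l : 'I_3) : i != j -> i != l -> j != l ->
  forall m, [\/ m = i, m = j | m = l].
Proof.
move=> ij il jl m.
have [->|/eqP mi] := m =P i; first by constructor 1.
have [->|/eqP mj] := m =P j; first by constructor 2.
have [->|/eqP ml] := m =P l; first by constructor 3.
move: ij il jl mi mj ml (ltn_ord i) (ltn_ord j) (ltn_ord l) (ltn_ord m).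
by rewrite -!val_eqE /=; lia.
Qed.

Lemma diag_spec (k : nat) (i j l : 'I_3) (sh : 'I_3 -> option nat) :
  uniq [:: i; j; l] -> (forall m t, sh m = Some t -> (t < hord i i m)%N) ->
  exists2 s, s \in diag_dofs k i j l & fits k i i sh s.
Proof.
move=> u sh_lt.
move: u; rewrite /= !inE negb_or !andbT => /andP[/andP[ij il] jl].
have ijl := ord3_cases ij il jl.
have [ji li lj] : [/\ j != i, l != i & l != j] by rewrite ![_ == i]eq_sym [l == j]eq_sym.
have shi : sh i = None.
  by case E : (sh i) => [t|//]; have := sh_lt _ _ E; rewrite /hord eqxx.
have shm m : [\/ sh m = None, sh m = Some 0%N | sh m = Some 1%N].
  case E : (sh m) => [[|[|t]]|]; [by constructor|by constructor| |by constructor].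
  by have := sh_lt _ _ E; have := hord_le2 i i m; lia.
(* [i] is always a moment direction because [hord i i i = 0]. Each of [j] and [l] goes to the
   derivative list at order one, to the test list when it carries a moment, and to neither at order
   zero. *)
exists (Dof i i [seq m <- [:: j; l] | sh m == Some 1%N]
  ((i, k%:Z - 2) :: [seq (m, k%:Z - 4) | m <- [:: j; l] & sh m == None])).
  by case: (shm j) => hj; case: (shm l) => hl; rewrite /= hj hl /= /diag_dofs !inE eqxx ?orbT.
have hi : hord i i i = 0%N by rewrite /hord eqxx.
have hj : hord i i j = 2%N by rewrite /hord ij.
have hl : hord i i l = 2%N by rewrite /hord il.
split => //=.
- by case: (shm j) => ej; case: (shm l) => el; rewrite /support_axes /= ?ej /= ?el /= ?inE ?negb_or ?ij ?il ?jl.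
- by split=> m; case: (ijl m) => ->; case: (shm j) => ej; case: (shm l) => el;
    rewrite /support_axes /= ?ej /= ?el /= ?inE ?shi ?ej ?el ?eqxx
      ?(negPf ij) ?(negPf il) ?(negPf jl) ?(negPf ji) ?(negPf li) ?(negPf lj) ?orbT.
- move=> m; case: (ijl m) => -> em; case: (shm j) => ej; case: (shm l) => el;
    rewrite ?em in ej el => //;
    rewrite /bound /= ?ej ?el ?em /= ?eqxx
      ?(negPf ij) ?(negPf il) ?(negPf jl) ?(negPf ji) ?(negPf li) ?(negPf lj) /= ?hi ?hj ?hl; lia.
Qed.

Lemma offdiag_spec (k : nat) (i j l : 'I_3) (sh : 'I_3 -> option nat) :
  uniq [:: i; j; l] -> (forall m t, sh m = Some t -> (t < hord i j m)%N) ->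
  exists2 s, s \in offdiag_dofs k i j l & fits k i j sh s.
Proof.
move=> u sh_lt.
move: u; rewrite /= !inE negb_or !andbT => /andP[/andP[ij il] jl].
have ijl := ord3_cases ij il jl.
have [ji li lj] : [/\ j != i, l != i & l != j] by rewrite ![_ == i]eq_sym [l == j]eq_sym.
have hi : hord i j i = 1%N by rewrite /hord eqxx ji.
have hj : hord i j j = 1%N by rewrite /hord eqxx ij.
have hl : hord i j l = 2%N by rewrite /hord il jl.
have shi : sh i = None \/ sh i = Some 0%N.
  case E : (sh i) => [[|t]|]; [by right| |by left].
  by have := sh_lt _ _ E; rewrite hi.
have shj : sh j = None \/ sh j = Some 0%N.
  case E : (sh j) => [[|t]|]; [by right| |by left].
  by have := sh_lt _ _ E; rewrite hj.
have shl : [\/ sh l = None, sh l = Some 0%N | sh l = Some 1%N].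
  case E : (sh l) => [[|[|t]]|]; [by constructor|by constructor| |by constructor].
  by have := sh_lt _ _ E; rewrite hl.
exists (Dof i j [seq m <- [:: l] | sh m == Some 1%N]
  ([seq (m, k%:Z - 3) | m <- [:: i; j] & sh m == None] ++
   [seq (m, k%:Z - 4) | m <- [:: l] & sh m == None])).
  by case: shi => ei; case: shj => ej; case: shl => el; rewrite /= ei ej el /= /offdiag_dofs !inE eqxx ?orbT.
split => //=.
- by case: shi => ei; case: shj => ej; case: shl => el; rewrite /support_axes /= ?ei /= ?ej /= ?el /= ?inE ?negb_or ?ij ?il ?jl.
- by split=> m; case: (ijl m) => ->; case: shi => ei; case: shj => ej; case: shl => el;
    rewrite /support_axes /= ?ei /= ?ej /= ?el /= ?inE ?ei ?ej ?el ?eqxx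
      ?(negPf ij) ?(negPf il) ?(negPf jl) ?(negPf ji) ?(negPf li) ?(negPf lj) ?orbT.
- move=> m; case: (ijl m) => -> em; case: shi => ei; case: shj => ej; case: shl => el;
    rewrite ?em in ei ej el => //;
    rewrite /bound /= ?ei ?ej ?el ?em /= ?eqxx
      ?(negPf ij) ?(negPf il) ?(negPf jl) ?(negPf ji) ?(negPf li) ?(negPf lj) /= ?hi ?hj ?hl; lia.
Qed.

(** Separation by tensor products needs every admissible shape to occur in the list. Entries below
    the diagonal are left to symmetry. *)
Lemma spec_exists (k : nat) (a b : 'I_3) (sh : 'I_3 -> option nat) : (a <= b)%N ->
  (forall m t, sh m = Some t -> (t < hord a b m)%N) ->
  exists2 s, s \in dofspecs k & fits k a b sh s.
Proof.
elim/ord3P: a; elim/ord3P: b => // _ hsh.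
- have [//|s ss ?] := @diag_spec k ax1 ax2 ax3 _ _ hsh.
  exists s; last by []. rewrite /dofspecs !mem_cat.
  apply/orP; left. exact: ss.
- have [//|s ss ?] := @offdiag_spec k ax1 ax2 ax3 _ _ hsh.
  exists s; last by []. rewrite /dofspecs !mem_cat.
  do 3 (apply/orP; right). apply/orP; left. exact: ss.
- have [//|s ss ?] := @offdiag_spec k ax1 ax3 ax2 _ _ hsh.
  exists s; last by []. rewrite /dofspecs !mem_cat.
  do 4 (apply/orP; right). apply/orP; left. exact: ss.
- have [//|s ss ?] := @diag_spec k ax2 ax1 ax3 _ _ hsh.
  exists s; last by []. rewrite /dofspecs !mem_cat.
  do 1 (apply/orP; right). apply/orP; left. exact: ss.
- have [//|s ss ?] := @offdiag_spec k ax2 ax3 ax1 _ _ hsh.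
  exists s; last by []. rewrite /dofspecs !mem_cat.
  do 5 (apply/orP; right). exact: ss.
- have [//|s ss ?] := @diag_spec k ax3 ax1 ax2 _ _ hsh.
  exists s; last by []. rewrite /dofspecs !mem_cat.
  do 2 (apply/orP; right). apply/orP; left. exact: ss.
Qed.

End Specs.

(** * Entries determined by tensor product conditions *)

Section Determination.
Context {R : realType}.

Lemma coord_subbox1 (T : @box R) s m :
  coord (subbox T s).1 m = if s m == Some true then coord T.2 m else coord T.1 m.
Proof. exact: coord_mkpt. Qed.

Lemma coord_subbox2 (T : @box R) s m :
  coord (subbox T s).2 m = if s m == Some false then coord T.1 m else coord T.2 m.
Proof. exact: coord_mkpt. Qed.

Lemma mem_entities (T : @box R) (A : seq 'I_3) (G : box) :
  G \in entities T A <->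
  exists s : {ffun 'I_3 -> option bool}, (forall m, (s m == None) = (m \in A)) /\ G = subbox T s.
Proof.
split=> [/mapP[s]|[s [sA ->]]].
  by rewrite mem_filter => /andP[/forallP sA _] ->; by exists s; split=> [m|//]; exact: (eqP (sA m)).
apply/mapP; exists s => //; rewrite mem_filter mem_enum andbT.
by apply/forallP => m; rewrite sA.
Qed.

Lemma bound_notin (d : seq ('I_3 * int)) m : m \notin unzip1 d -> bound d m = 0.
Proof.
by move=> md; rewrite /bound nth_default // size_map leqNgt -(size_map fst) index_mem.
Qed.

Lemma Qspace_mono d (q : 'I_3 -> nat) : (forall m, (q m)%:Z <= bound d m) ->
  Qspace d (mono q : R3 R -> R).
Proof.
move=> qd; exists 1%N, (fun=> 1), (fun=> q); split => // x.
by rewrite big_ord1 mul1r.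
Qed.

Lemma Qspace_psum d (f : R3 R -> R) : Qspace d f <->
  exists n (c : 'I_n -> R) e, (forall r m, (e r m)%:Z <= bound d m) /\ f = psum c e.
Proof.
split=> [[n [c [e [eb fE]]]]|[n [c [e [eb ->]]]]]; last by exists n, c, e; split.
by exists n, c, e; split => //; apply/funext.
Qed.

Lemma Qspace_polyfun d (f : R3 R -> R) : Qspace d f -> polyfun f.
Proof. by move=> /Qspace_psum[n [c [e [_ ->]]]]; exists n, c, e. Qed.

Section Conditions.
Variables (k : nat) (k3 : (3 <= k)%N) (a b : 'I_3).
Variables (T : @box R) (cT : is_cell T).

Definition valid_conds (x : 'I_3 -> cond) := forall m, valid_cond k a b m (x m).

Section OneDof.
Variables (x : 'I_3 -> cond) (s : dofspec).
Hypotheses (vx : valid_conds x) (fs : fits k a b (fun m => (x m).1.1) s).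

Lemma entities_conds : subbox T (conds_entity x) \in entities T (support_axes s).
Proof.
apply/mem_entities; exists (conds_entity x); split => // m.
by case: fs => _ _ _ [_ ->] _; rewrite ffunE; case: (x m).1.1.
Qed.

Lemma Qspace_conds_mono : Qspace (test s) (conds_mono x : R3 R -> R).
Proof.
apply: Qspace_mono => m; case: fs => _ _ _ [_ sm] bm.
case E : (x m).1.1 => [t|].
  by rewrite bound_notin // -[_ \notin _]/(m \notin support_axes s) sm E.
rewrite bm //; have := vx m; rewrite /valid_cond E.
by set h := hord _ _ _; lia.
Qed.

Lemma dof_conds (u : field3) n (c : 'I_n -> R) e : entry u a b = psum c e ->
  dof s (subbox T (conds_entity x)) (conds_mono x) u =
  \sum_r c r * \prod_m cond_val T m (x m) (e r m).
Proof.
case: fs => ra cb [ud us] [dm sm] _ ue.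
have GE1 m : coord (subbox T (conds_entity x)).1 m =
    if (x m).1.1 is Some _ then coord (if (x m).1.2 then T.2 else T.1) m else coord T.1 m.
  by rewrite coord_subbox1 ffunE; case: (x m).1.1 => //; case: (x m).1.2.
have GE2 m : (x m).1.1 = None -> coord (subbox T (conds_entity x)).2 m = coord T.2 m.
  by rewrite coord_subbox2 ffunE => ->.
rewrite /conds_mono (dof_psum (c := c) (e := e)) ?ra ?cb //; last first.
  by move=> m; rewrite sm => /eqP xm; rewrite GE1 GE2 // xm; exact: cT.
apply: eq_bigr => r _; congr (_ * _); apply: eq_bigr => m _.
have := vx m; rewrite dm sm /cond_val /valid_cond GE1; case E : (x m).1.1 => [t|] /=.
  (* As [t < hord a b m <= 2], only the orders [0] and [1] occur, where the falling factorial is [1]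
     or the exponent itself. *)
  have := hord_le2 a b m; move: t E => [|[|t]] E; rewrite ?ffactn0 ?ffactn1 ?addn0 //.
  by move=> h1 h2; have := leq_trans h2 h1.
by rewrite GE2 // mul1r subn0.
Qed.

End OneDof.

Variables (n : nat) (c : 'I_n -> R) (e : 'I_n -> 'I_3 -> nat).
Hypothesis eb : forall r m, (e r m <= k - 2 + hord a b m)%N.

Lemma psum_eq0 : (forall x, valid_conds x ->
    \sum_r c r * \prod_m cond_val T m (x m) (e r m) = 0) ->
  forall y, psum c e y = 0.
Proof.
move=> x0 y; apply: (tensor_eq0 (V := valid_cond k a b) (lam := @cond_val R T)
  (out := fun m i => coord y m ^+ i)); last by move=> x vx; exact: (x0 x vx).
by move=> m d; apply: (@cond_val_unisolvent _ k a b m T _ d (e^~ m) (coord y m)) => //; lia.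
Qed.

(** In direction [l] the output, evaluation at [y], coincides with the only condition kept there,
    the value at the end [v]; that condition is admissible because [0 < hord a b l]. The entry thus
    vanishes on the whole plane of the face. *)
Lemma psum_face_eq0 l (v : bool) : (forall x, valid_conds x -> x l = (Some 0%N, v, 0%N) ->
    \sum_r c r * \prod_m cond_val T m (x m) (e r m) = 0) ->
  forall y, coord y l = coord (if v then T.2 else T.1) l -> (0 < hord a b l)%N -> psum c e y = 0.
Proof.
move=> x0 y yl hl.
pose V m x := valid_cond k a b m x /\ (m = l -> x = (Some 0%N, v, 0%N)).
apply: (tensor_eq0 (V := V) (lam := @cond_val R T) (out := fun m i => coord y m ^+ i)).
  move=> m d; have [->|/eqP ml] := m =P l; move=> Vd.
    rewrite -[RHS](Vd (Some 0%N, v, 0%N)); last by split.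
    by apply: eq_bigr => r _; rewrite /cond_val /= yl ffactn0 mul1r subn0.
  apply: (@cond_val_unisolvent _ k a b m T _ d (e^~ m) (coord y m)) => //; first by lia.
  by move=> x vx; apply: Vd; split => // /eqP; rewrite (negPf ml).
by move=> x Vx; apply: x0 => [m|]; [exact: (Vx m).1|exact: (Vx l).2].
Qed.

End Conditions.

Lemma Sigma_entry k (u : @field3 R) a b : (3 <= k)%N -> Sigma k u ->
  exists n (c : 'I_n -> R) e, (forall r m, (e r m <= k - 2 + hord a b m)%N) /\
    entry u a b = psum c e.
Proof.
move=> k3 [_ uS].
have aux (i j l : 'I_3) : uniq [:: i; j; l] ->
    (exists n (c : 'I_n -> R) e, (forall r m, (e r m <= k - 2 + hord i i m)%N) /\
      entry u i i = psum c e) /\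
    (exists n (c : 'I_n -> R) e, (forall r m, (e r m <= k - 2 + hord i j m)%N) /\
      entry u i j = psum c e).
  move=> u3; have [/Qspace_psum[n [c [e [eb ->]]]] /Qspace_psum[n' [c' [e' [eb' ->]]]]] := uS _ _ _ u3.
  move: u3; rewrite /= !inE negb_or !andbT => /andP[/andP[ij il] jl].
  have [ji li lj] : [/\ j != i, l != i & l != j] by rewrite ![_ == i]eq_sym [l == j]eq_sym.
  split; [exists n, c, e|exists n', c', e']; split => // r m.
    have := eb r m; rewrite /bound /hord /=.
    by case: (ord3_cases ij il jl m) => ->; rewrite ?eqxx ?(negPf ij) ?(negPf il) ?(negPf jl)
      ?(negPf ji) ?(negPf li) ?(negPf lj) /=; lia.
  have := eb' r m; rewrite /bound /hord /=.
  by case: (ord3_cases ij il jl m) => ->; rewrite ?eqxx ?(negPf ij) ?(negPf il) ?(negPf jl)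
    ?(negPf ji) ?(negPf li) ?(negPf lj) /=; lia.
have [->|/eqP ab] := a =P b.
  have /aux[] // : uniq [:: b; if b == ax1 then ax2 else ax1; if b == ax3 then ax2 else ax3].
  by elim/ord3P: b.
have [l /aux[]//] : exists l, uniq [:: a; b; l].
move: ab; elim/ord3P: a; elim/ord3P: b => // _; [exists ax3|exists ax2|exists ax3|exists ax1|exists ax2|exists ax1] => //.
Qed.

End Determination.

(** * Bases of a space and of its dual *)

Section Bases.
Context {R : realType} (V : lmodType R) (S : set V).

Lemma is_basis_free (b : seq V) (c : 'rV[R]_(size b)) : is_basis S b -> S 0 ->
  \sum_(r < size b) c 0 r *: b`_r = 0 -> c = 0.
Proof.
move=> [_ bS] S0 c0; have [d [_ dU]] := bS _ S0.
rewrite -(dU c) // (dU 0) //; rewrite big1 // => r _.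
by rewrite mxE scale0r.
Qed.

(** The coordinates of [b] in [b'] form a matrix with independent rows, and these cannot outnumber
    its columns. *)
Lemma leq_size_basis (b b' : seq V) : is_basis S b -> is_basis S b' -> S 0 ->
  (size b <= size b')%N.
Proof.
move=> bb bb' S0; have [bS _] := bb; have [_ b'S] := bb'.
have /choice[P PE] : forall r : 'I_(size b), exists c : 'rV[R]_(size b'),
    b`_r = \sum_(s < size b') c 0 s *: b'`_s.
  by move=> r; have [|c [cE _]] := b'S b`_r; [apply/bS/mem_nth|exists c].
suff /eqP <- : row_free (\matrix_r P r) by exact: rank_leq_col.
apply: inj_row_free => v vP; apply: (is_basis_free bb S0).
transitivity (\sum_(s < size b') (v *m \matrix_r P r) 0 s *: b'`_s); last first.
  by rewrite vP big1 // => s _; rewrite mxE scale0r.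
under [RHS]eq_bigr => s _ do rewrite mxE scaler_suml.
rewrite exchange_big /=; apply: eq_bigr => r _; rewrite PE scaler_sumr.
by apply: eq_bigr => s _; rewrite mxE scalerA.
Qed.

Lemma size_basis (b b' : seq V) : is_basis S b -> is_basis S b' -> S 0 ->
  size b = size b'.
Proof. by move=> bb bb' S0; apply/eqP; rewrite eqn_leq !leq_size_basis. Qed.

Lemma is_basis_family (I : finType) (g : I -> V) :
  (forall i, S (g i)) ->
  (forall v, S v -> exists c : I -> R, v = \sum_i c i *: g i) ->
  (forall c : I -> R, \sum_i c i *: g i = 0 -> forall i, c i = 0) ->
  is_basis S [seq g i | i <- enum I].
Proof.
move=> gS gspan gfree; set b := map _ _.
have sb : #|I| = size b by rewrite size_map -cardE.
pose h (i : I) : 'I_(size b) := cast_ord sb (enum_rank i).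
pose h' (r : 'I_(size b)) : I := enum_val (cast_ord (esym sb) r).
have hK : cancel h h' by move=> i; rewrite /h' /h cast_ordK enum_rankK.
have h'K : cancel h' h by move=> r; rewrite /h' /h enum_valK cast_ordKV.
have bh i : b`_(h i) = g i.
  by rewrite /b (nth_map i) ?nth_enum_rank // -cardE /=; exact: ltn_ord.
have sumE (c : 'rV[R]_(size b)) :
    \sum_(r < size b) c 0 r *: b`_r = \sum_i c 0 (h i) *: g i.
  rewrite (reindex h); last by apply: onW_bij; exists h'.
  by apply: eq_bigr => i _; rewrite bh.
split=> [v /mapP[i _ ->] //|v Sv].
have [c cE] := gspan v Sv.
exists (\row_r c (h' r)); split.
  by rewrite sumE cE; apply: eq_bigr => i _; rewrite mxE hK.
move=> d dE; apply/rowP => r; rewrite mxE.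
have := gfree (fun i => c i - d 0 (h i)) _ (h' r); rewrite h'K => dc.
apply/eqP; rewrite -subr_eq0 dc //.
under eq_bigr do rewrite scalerBl.
by rewrite sumrB -cE -sumE -dE subrr.
Qed.

Hypothesis S0 : S 0.
Hypothesis SD : forall (a : R) u v, S u -> S v -> S (a *: u + v).

Lemma linear_on_sum (phi : V -> R) n (c : 'I_n -> R) (f : 'I_n -> V) :
  linear_on S phi -> (forall r, S (f r)) ->
  S (\sum_r c r *: f r) /\ phi (\sum_r c r *: f r) = \sum_r c r * phi (f r).
Proof.
move=> lphi fS; have phi0 : phi 0 = 0.
  by have := lphi 1 0 0 S0 S0; rewrite scale1r addr0 mul1r => /eqP; rewrite addrC -subr_eq subrr => /eqP.
elim: n c f fS => [c f _|n IH c f fS]; first by rewrite !big_ord0.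
have [Sn En] := IH (fun r => c (lift ord0 r)) (fun r => f (lift ord0 r)) (fun r => fS _).
by rewrite !big_ord_recl; split; [exact: SD|rewrite lphi // En].
Qed.

(* Separation and equality of dimensions make the matrix of values on a basis
   invertible. *)
Lemma unisolvent_separating (N : seq (V -> R)) (b : seq V) :
  is_basis S b -> size N = size b ->
  (forall r, (r < size N)%N -> linear_on S (nth (fun=> 0) N r)) ->
  (forall u, S u -> (forall r, (r < size N)%N -> nth (fun=> 0) N r u = 0) -> u = 0) ->
  unisolvent S N.
Proof.
move=> bb sN Nlin Nsep; split => // phi lphi; have [bS bspan] := bb.
have bS' (s : 'I_(size b)) : S b`_s by apply/bS/mem_nth.
pose M : 'M[R]_(size N, size b) := \matrix_(r, s) nth (fun=> 0) N r b`_s.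
have Mfree : row_free M^T.
  apply: inj_row_free => v vM; apply: (is_basis_free bb S0).
  apply: Nsep => [|r hr].
    by have [] := @linear_on_sum (fun=> 0) _ (v 0) (fun s => b`_s) _ bS'; first by move=> *; rewrite mulr0 addr0.
  have [_ ->] := @linear_on_sum _ _ (v 0) (fun s => b`_s) (Nlin r hr) bS'.
  have := congr1 (fun A : 'rV_(size N) => A 0 (Ordinal hr)) vM; rewrite !mxE => h; rewrite -[RHS]h.
  by apply: eq_bigr => s _; rewrite !mxE.
have rM : \rank M = size b by move/eqP: Mfree; rewrite mxrank_tr.
have fM : row_free M by rewrite /row_free rM sN.
have FM : row_full M by rewrite /row_full rM.
(* Expressing [phi] through [N] is a linear system with matrix [M], whose right-hand side lists the
   values of [phi] on the basis. *)
have valE (c : 'rV[R]_(size N)) : (forall u, S u -> phi u = \sum_(r < size N) c 0 r * nth (fun=> 0) N r u) <->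
    \row_s phi b`_s = c *m M.
  split=> [cE|cE u Su].
    by apply/rowP => s; rewrite !mxE cE //; apply: eq_bigr => r _; rewrite mxE.
  have [d [-> _]] := bspan u Su.
  have [_ ->] := @linear_on_sum phi _ (d 0) (fun s => b`_s) lphi bS'.
  under [RHS]eq_bigr => r _.
    have [_ ->] := @linear_on_sum _ _ (d 0) (fun s => b`_s) (Nlin r (ltn_ord r)) bS'.
    rewrite big_distrr /=; over.
  rewrite exchange_big /=; apply: eq_bigr => s _.
  have := congr1 (fun A : 'rV_(size b) => A 0 s) cE; rewrite !mxE => ->.
  by rewrite big_distrr /=; apply: eq_bigr => r _; rewrite mxE mulrCA.
have /submxP[c cE] := submx_full (\row_s phi b`_s) FM.
exists c; split; first exact/valE.
by move=> d /valE; rewrite cE => /(row_free_inj fM).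
Qed.

End Bases.

(** * Monomial bases and dimensions *)

Section Exponents.
Variable n : 'I_3 -> nat.

Definition exponents := ('I_(n ax1) * 'I_(n ax2) * 'I_(n ax3))%type.

Definition expo (x : exponents) (m : 'I_3) : nat :=
  if m == ax1 then x.1.1 : nat else if m == ax2 then x.1.2 : nat else x.2.

Lemma expo_lt x m : (expo x m < n m)%N.
Proof. by elim/ord3P: m; exact: ltn_ord. Qed.

Lemma expo_inj x y : (forall m, expo x m = expo y m) -> x = y.
Proof.
case: x y => [[x1 x2] x3] [[y1 y2] y3] xy; congr (_, _, _); apply: val_inj.
- exact: (xy ax1).
- exact: (xy ax2).
- exact: (xy ax3).
Qed.

Lemma expo_exists (e : 'I_3 -> nat) : (forall m, (e m < n m)%N) ->
  exists x, forall m, expo x m = e m.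
Proof.
move=> en; exists (Ordinal (en ax1), Ordinal (en ax2), Ordinal (en ax3)).
by elim/ord3P.
Qed.

Lemma card_exponents : #|{: exponents}| = (\prod_m n m)%N.
Proof.
rewrite !card_prod !card_ord !big_ord_recl big_ord0 muln1 mulnA.
by congr (n _ * n _ * n _)%N; exact: val_inj.
Qed.

End Exponents.

Section MonomialBasis.
Context {R : realType}.

Lemma psum_span (n : 'I_3 -> nat) N (c : 'I_N -> R) e :
  (forall r m, (e r m < n m)%N) ->
  exists d : exponents n -> R, psum c e = fun y => \sum_x d x * mono (expo x) y.
Proof.
move=> en; have /choice[f fE] := fun r => expo_exists (en r).
exists (fun x => \sum_(r | f r == x) c r); apply/funext => y.
rewrite /psum (partition_big f predT) //=; apply: eq_bigr => x _.
rewrite big_distrl /=; apply: eq_bigr => r /eqP <-.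
by congr (_ * mono _ _); apply/funext => m; rewrite fE.
Qed.

(** [tensor_eq0] with evaluations at all reals as conditions and the extraction of one coefficient
    as output; in one variable, a polynomial vanishing everywhere is zero. *)
Lemma mono_free (n : 'I_3 -> nat) (c : exponents n -> R) :
  (forall y, \sum_x c x * mono (expo x) y = 0) -> forall x, c x = 0.
Proof.
move=> c0 x.
have sumE (F : exponents n -> R) : \sum_x F x = \sum_(r < #|{: exponents n}|) F (enum_val r).
  by rewrite -big_enum_val.
have : \sum_(r < #|{: exponents n}|) c (enum_val r) *
    \prod_m (expo (enum_val r) m == expo x m)%:R = 0.
  apply: (tensor_eq0 (V := fun _ (_ : R) => True) (lam := fun _ y i => y ^+ i)
    (out := fun m i => (i == expo x m)%:R) (e := fun r => expo (enum_val r))).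
    move=> m d d0; pose p : {poly R} := \sum_r d r *: 'X^(expo (enum_val r) m).
    have p0 : p = 0.
      apply: (@roots_geq_poly_eq0 _ p [seq i%:R | i <- iota 0 (size p)]).
      - apply/allP => _ /mapP[i _ ->]; rewrite /root horner_sum.
        under eq_bigr do rewrite hornerZ hornerXn.
        by apply/eqP/d0.
      - by rewrite map_inj_uniq ?iota_uniq // => i j /eqP; rewrite eqr_nat => /eqP.
      - by rewrite size_map size_iota.
    rewrite -[RHS](coef0 R (expo x m)) -p0 coef_sum; apply: eq_bigr => r _.
    by rewrite coefZ coefXn eq_sym.
  move=> z _; rewrite -[RHS](c0 (mkpt z)) sumE; apply: eq_bigr => r _.
  by congr (_ * _); apply: eq_bigr => m _; rewrite coord_mkpt.
rewrite -(sumE (fun z => c z * \prod_m (expo z m == expo x m)%:R)) (bigD1 x) //=.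
rewrite big1 ?mulr1 => [|m _]; last by rewrite eqxx.
rewrite big1 ?addr0 // => z zx.
have [m /negPf zm] : exists m, expo z m != expo x m.
  apply: contrapT => /forallNP h; move/eqP: zx; apply; apply: expo_inj => m.
  by have /negP/negPn/eqP := h m.
by rewrite (bigD1 m) //= zm mul0r mulr0.
Qed.

(* The number of exponents allowed by the bound [z], none if [z < 0]. *)
Definition nexp (z : int) : nat := if z is Posz n then n.+1 else 0%N.

Lemma ltn_nexp (i : nat) (z : int) : (i < nexp z)%N = (i%:Z <= z).
Proof. by case: z => [n|n] /=; rewrite ?ltnS ?lez_nat. Qed.

Lemma sum_fctE (I : finType) (T : Type) (W : lmodType R) (c : I -> R) (g : I -> T -> W) y :
  (\sum_i c i *: g i) y = \sum_i c i *: g i y.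
Proof. by elim/big_ind2: _ => // _ u _ v <- <-. Qed.

Lemma is_basis_Qspace d : is_basis (@Qspace R d)
  [seq (mono (expo x) : R3 R -> R) | x <- enum {: exponents (nexp \o bound d)}].
Proof.
have sumE (c : exponents (nexp \o bound d) -> R) y :
  (\sum_x c x *: (mono (expo x) : R3 R -> R^o)) y = \sum_x c x * mono (expo x) y.
  exact: sum_fctE.
apply: is_basis_family => [x|f /Qspace_psum[N [c [e [eb ->]]]]|c c0].
- by apply: Qspace_mono => m; rewrite -ltn_nexp; exact: expo_lt.
- have [|d' ->] := @psum_span (nexp \o bound d) _ c e.
    by move=> r m /=; rewrite ltn_nexp.
  by exists d'; apply/funext => y; rewrite -sumE.
- by apply: mono_free => y; rewrite -sumE [X in X y]c0.
Qed.

Lemma Qspace0 d : @Qspace R d 0.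
Proof.
apply/Qspace_psum; exists 0%N, (fun=> 0), (fun _ _ => 0%N); split; first by case.
by apply/funext => x; rewrite /psum big_ord0.
Qed.

Lemma size_Qspace_basis d (b : seq (R3 R -> R)) : is_basis (Qspace d) b ->
  size b = (\prod_m nexp (bound d m))%N.
Proof.
move=> bb; rewrite (size_basis bb (is_basis_Qspace d) (Qspace0 d)).
by rewrite size_map -cardE card_exponents.
Qed.

End MonomialBasis.

Lemma big_ord3 (T : Type) (idx : T) (op : Monoid.law idx) (F : 'I_3 -> T) :
  \big[op/idx]_m F m = op (op (F ax1) (F ax2)) (F ax3).
Proof.
rewrite !big_ord_recl big_ord0 Monoid.mulm1 Monoid.mulmA.
by congr (op (op (F _) (F _)) (F _)); exact: val_inj.
Qed.

Section SigmaBasis.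
Context {R : realType}.
Variables (k : nat) (k3 : (3 <= k)%N).

(** The bounds are strict, as in [exponents], so that the zero space also has a bound. *)
Definition poly_lt (n : 'I_3 -> nat) (f : R3 R -> R) :=
  exists N (c : 'I_N -> R) e, (forall r m, (e r m < n m)%N) /\ f = psum c e.

Lemma poly_lt_linear n a f g : poly_lt n f -> poly_lt n g -> poly_lt n (a *: f + g).
Proof.
move=> [n1 [c1 [e1 [b1 ->]]]] [n2 [c2 [e2 [b2 ->]]]].
exists (n1 + n2)%N, (fun r => match fintype.split r with inl i => a * c1 i | inr i => c2 i end),
  (fun r => match fintype.split r with inl i => e1 i | inr i => e2 i end).
split; first by move=> r m; case: fintype.split.
apply/funext => x; transitivity (a * psum c1 e1 x + psum c2 e2 x); first by [].
rewrite /psum big_split_ord /=; congr (_ + _).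
  by rewrite big_distrr; apply: eq_bigr => r _; rewrite (unsplitK (inl r)) /= mulrA.
by apply: eq_bigr => r _; rewrite (unsplitK (inr r)).
Qed.

Lemma poly_lt0 n : poly_lt n 0.
Proof.
exists 0%N, (fun=> 0), (fun _ _ => 0%N); split; first by case.
by apply/funext => x; rewrite /psum big_ord0.
Qed.

Lemma poly_lt_Qspace d n f : (forall m, n m = nexp (bound d m)) ->
  poly_lt n f -> Qspace d f.
Proof.
move=> nd [N [c [e [eb ->]]]]; apply/Qspace_psum; exists N, c, e; split => // r m.
by rewrite -ltn_nexp -nd.
Qed.

(** The degree bound [k - 2 + hord a b m] plus one. *)
Definition ncoef (a b m : 'I_3) := (k - 1 + hord a b m)%N.

Lemma hordC a b m : hord a b m = hord b a m.
Proof. by rewrite /hord addnC. Qed.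

Lemma SigmaP (u : @field3 R) : Sigma k u <->
  (forall x, (u x)^T = u x) /\ forall a b, poly_lt (ncoef a b) (entry u a b).
Proof.
split=> [Su|[us ue]].
  split; first by have [] := Su.
  move=> a b; have [n [c [e [eb eE]]]] := Sigma_entry a b k3 Su.
  exists n, c, e; split => // r m; have := eb r m; rewrite /ncoef; lia.
split => // i j l; rewrite /= !inE negb_or !andbT => /andP[/andP[ij il] jl].
have [ji li lj] : [/\ j != i, l != i & l != j] by rewrite ![_ == i]eq_sym [l == j]eq_sym.
have nk (h : nat) : (h <= 2)%N -> nexp (k%:Z - 2 + h%:Z) = (k - 1 + h)%N.
  by case: k k3 => [|[|[|n]]] // _; case: h => [|[|[|]]] // _ /=; lia.
split; apply: (@poly_lt_Qspace _ _ _ _ (ue _ _)) => m; rewrite /ncoef -nk ?hord_le2 //;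
  congr nexp; rewrite /bound /hord;
  by case: (ord3_cases ij il jl m) => ->; rewrite /= ?eqxx ?(negPf ij) ?(negPf il) ?(negPf jl)
    ?(negPf ji) ?(negPf li) ?(negPf lj) /=; lia.
Qed.

Lemma Sigma_linear (a : R) u v : Sigma k u -> Sigma k v -> Sigma k (a *: u + v).
Proof.
move=> /SigmaP[us ue] /SigmaP[vs ve]; apply/SigmaP; split=> [x|i j].
  transitivity ((a *: u x + v x)^T); first by [].
  by rewrite linearP /= us vs.
rewrite (_ : entry _ i j = a *: entry u i j + entry v i j); first exact: poly_lt_linear.
apply/funext => x; transitivity ((a *: u x + v x) i j); first by [].
by rewrite !mxE.
Qed.

Lemma Sigma0 : Sigma k (0 : @field3 R).
Proof.
apply/SigmaP; split=> [x|i j]; first exact: trmx0.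
rewrite (_ : entry _ i j = 0); first exact: poly_lt0.
by apply/funext => x; rewrite /entry [LHS]mxE.
Qed.

(* Only the entries on or above the diagonal carry exponents. *)
Definition sigma_ncoef (p : 'I_3 * 'I_3) (m : 'I_3) : nat :=
  if (p.1 <= p.2)%N then ncoef p.1 p.2 m else 0%N.

Definition sigma_index := {p : 'I_3 * 'I_3 & exponents (sigma_ncoef p)}.

Definition sym_unit (p : 'I_3 * 'I_3) : 'M[R]_3 :=
  \matrix_(a, b) (((a, b) == p) || ((b, a) == p))%:R.

Definition sigma_mono (t : sigma_index) : @field3 R :=
  fun y => mono (expo (tagged t)) y *: sym_unit (tag t).

(** Below the diagonal the type of exponents is empty. *)
Lemma expo_le (p : 'I_3 * 'I_3) (x : exponents (sigma_ncoef p)) : (p.1 <= p.2)%N.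
Proof.
have : (0 < sigma_ncoef p ax1)%N := leq_ltn_trans (leq0n _) (expo_lt x ax1).
by rewrite /sigma_ncoef; case: ifP.
Qed.

Lemma sigma_sum_entry (c : sigma_index -> R) y (a b : 'I_3) : (a <= b)%N ->
  (\sum_t c t *: sigma_mono t) y a b =
  \sum_x c (Tagged (fun p => exponents (sigma_ncoef p)) (x : exponents (sigma_ncoef (a, b))))
     * mono (expo x) y.
Proof.
move=> ab; rewrite sum_fctE summxE.
transitivity (\sum_p \sum_(x : exponents (sigma_ncoef p))
   c (Tagged (fun p => exponents (sigma_ncoef p)) x) * (mono (expo x) y * sym_unit p a b)).
  rewrite (sig_big_dep xpredT (fun _ _ => true)) /=.
  by apply: eq_big => [[p x]|[p x] _] //; rewrite !mxE.
rewrite (bigD1 (a, b)) //= [X in _ + X]big1 ?addr0 => [|p pab].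
  by apply: eq_bigr => x _; rewrite mxE eqxx mulr1.
apply: big1 => x _; rewrite mxE eq_sym (negPf pab) /=.
(* The other case of [sym_unit]: [p = (b, a)] would give [b <= a] by [expo_le], hence [a = b] and
   [p = (a, b)], which is excluded. *)
case: eqP => [pE|_]; last by rewrite !mulr0.
case/eqP: pab; have := expo_le x; clear -ab pE; rewrite -pE /= => ba.
by congr (_, _); apply: val_inj; apply/eqP; rewrite eqn_leq ab ba.
Qed.

Lemma Sigma_sigma_mono t : Sigma k (sigma_mono t).
Proof.
apply/SigmaP; split=> [x|a b].
  rewrite /sigma_mono linearZ /=; congr (_ *: _).
  by apply/matrixP => a b; rewrite !mxE orbC.
case: t => p x /=; have px := expo_le x.
have [abp|abp] := boolP (((a, b) == p) || ((b, a) == p)); last first.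
  rewrite (_ : entry _ a b = 0); first exact: poly_lt0.
  by apply/funext => y; rewrite /entry /sigma_mono !mxE (negPf abp) mulr0.
exists 1%N, (fun=> 1), (fun=> expo x); split.
  move=> _ m; rewrite (leq_trans (expo_lt x m)) // /sigma_ncoef px.
  by case/orP: abp => /eqP <-; rewrite /ncoef //= hordC.
by apply/funext => y; rewrite /entry /sigma_mono !mxE abp mulr1 /psum big_ord1 mul1r.
Qed.

Lemma is_basis_Sigma : is_basis (@Sigma R k) [seq sigma_mono t | t <- enum {: sigma_index}].
Proof.
apply: is_basis_family => [|u /SigmaP[us ue]|c c0].
- exact: Sigma_sigma_mono.
- have dex : forall p : 'I_3 * 'I_3, exists d : exponents (sigma_ncoef p) -> R,
      (p.1 <= p.2)%N -> entry u p.1 p.2 = fun y => \sum_x d x * mono (expo x) y.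
    move=> p; have [pp|pp] := boolP (p.1 <= p.2)%N; last by exists (fun=> 0).
    have [N [c [e [eb ->]]]] := ue p.1 p.2.
    have [|d ->] := @psum_span _ (sigma_ncoef p) _ c e; last by exists d.
    by move=> r m; rewrite /sigma_ncoef pp.
  pose d p := projT1 (cid (dex p)).
  have dE (p : 'I_3 * 'I_3) : (p.1 <= p.2)%N -> entry u p.1 p.2 = fun y => \sum_x d p x * mono (expo x) y.
    exact: projT2 (cid (dex p)).
  exists (fun t => d (tag t) (tagged t)); apply/funext => y; apply/matrixP.
  have upper (a b : 'I_3) : (a <= b)%N -> u y a b = (\sum_t d (tag t) (tagged t) *: sigma_mono t) y a b.
    move=> ab; rewrite (sigma_sum_entry (fun t => d (tag t) (tagged t))) //=.
    by have := congr1 (fun f => f y) (dE (a, b) ab).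
  have sSig : Sigma k (\sum_t d (tag t) (tagged t) *: sigma_mono t).
    have := @linear_on_sum _ _ (Sigma k) Sigma0 Sigma_linear (fun=> 0) #|{: sigma_index}|
      (fun r => d (tag (enum_val r)) (tagged (enum_val r))) (fun r => sigma_mono (enum_val r)).
    case=> [|r|]; [by move=> *; rewrite mulr0 addr0|exact: Sigma_sigma_mono|].
    by rewrite -(big_enum_val (A := {: sigma_index}) (fun t => d (tag t) (tagged t) *: sigma_mono t)).
  have [ss _] := iffLR (SigmaP _) sSig.
  move=> a b; have [ab|ba] := leqP a b; first exact: upper.
  by rewrite -us mxE upper ?(ltnW ba) // -[in RHS]ss mxE.
- move=> [p x]; have px := expo_le x.
  apply: (@mono_free _ _ (fun x => c (Tagged (fun p => exponents (sigma_ncoef p)) x))) => y.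
  case: p x px => a b x ab; rewrite -sigma_sum_entry //.
  by rewrite c0 [LHS]mxE.
Qed.

Lemma card_sigma_index : #|{: sigma_index}| =
  (3 * ((k - 1) * (k + 1) * (k + 1)) + 3 * (k * k * (k + 1)))%N.
Proof.
rewrite card_tagged sumnE big_map big_enum /=.
under eq_bigr do rewrite card_exponents.
transitivity (\sum_a \sum_b \prod_m sigma_ncoef (a, b) m)%N.
  by rewrite pair_big; apply: eq_bigr => -[].
rewrite !big_ord3 /sigma_ncoef /ncoef /hord /=.
rewrite !(addn0, muln0, add0n, mul0n).
have -> : (k - 1 + 2 = k + 1)%N by lia.
have -> : (k - 1 + 1 = k)%N by lia.
ring.
Qed.

End SigmaBasis.

(** * Counting the degrees of freedom *)

Section Count.
Context {R : realType}.
Variables (k : nat) (k3 : (3 <= k)%N).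

Lemma size_entities (T : @box R) (A : seq 'I_3) :
  size (entities T A) = (\prod_m if m \in A then 1 else 2)%N.
Proof.
rewrite size_map.
pose F m := [pred o : option bool | (o == None) == (m \in A)].
transitivity #|family F|.
  rewrite size_filter -sum1_count big_enum_cond sum1_card; apply: eq_card => s.
  by rewrite !inE; apply: eq_forallb => m; rewrite !inE.
rewrite card_family foldrE big_map big_enum /=; apply: eq_bigr => m _.
case: (m \in A).
  by rewrite (@fintype.eq_card1 _ None) // => -[].
rewrite (@fintype.eq_card _ _ (predC1 None)) ?cardC1 ?card_option ?card_bool //.
by case.
Qed.

Definition spec_size (s : dofspec) : nat :=
  (\prod_m if m \in support_axes s then nexp (bound (test s) m) else 2)%N.

(** The numbers of entities and of test functions are both products over the directions: a free
    direction offers one choice of entity, a frozen one offers two choices and, its bound being [0],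
    a single exponent. *)
Lemma size_dof_group (T : @box R) (B : @box R -> seq ('I_3 * int) -> seq (R3 R -> R)) s :
  (forall G d, is_basis (@Qspace R d) (B G d)) ->
  size [seq dof s G p | G <- entities T (support_axes s), p <- test_basis B G (test s)]
  = spec_size s.
Proof.
move=> Bb.
have tb G : size (test_basis B G (test s)) = (\prod_m nexp (bound (test s) m))%N.
  rewrite /test_basis; case E : (test s) => [|t d].
    by rewrite big1 // => m _; rewrite bound_notin.
  exact: size_Qspace_basis.
rewrite size_allpairs_dep; under eq_map do rewrite tb.
rewrite sumnE big_map big_const_seq count_predT iter_addn_0 size_entities mulnC -big_split /=.
apply: eq_bigr => m _; case: ifPn => [_|ms]; first by rewrite mul1n.
by rewrite bound_notin.
Qed.

Lemma prod_ord3_perm (i j l : 'I_3) (F : 'I_3 -> nat) : i != j -> i != l -> j != l ->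
  (\prod_m F m = F i * F j * F l)%N.
Proof.
move=> ij il jl.
have [ji li lj] : [/\ j != i, l != i & l != j] by rewrite ![_ == i]eq_sym [l == j]eq_sym.
rewrite (bigD1 i) //= (bigD1 j) //= (bigD1 l) /= ?li ?lj //.
rewrite big1 ?muln1 ?mulnA // => m /andP[/andP[mi mj] ml].
by case: (ord3_cases ij il jl m) mi mj ml => ->; rewrite eqxx.
Qed.

(** For [3 <= k] truncated subtraction counts correctly: at [k = 3] the bound [k - 4] is negative
    and admits no exponent. *)
Lemma nexp_sub : [/\ nexp (k%:Z - 2) = (k - 1)%N, nexp (k%:Z - 3) = (k - 2)%N &
  nexp (k%:Z - 4) = (k - 3)%N].
Proof.
case: k k3 => [|[|[|[|n]]]] // _.
have -> : n.+4%:Z - 2 = n.+2 by lia.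
have -> : n.+4%:Z - 3 = n.+1 by lia.
have -> : n.+4%:Z - 4 = n by lia.
by split; rewrite /=; lia.
Qed.

(** The items expand [(k - 1) * (4 + (k - 3)) * (4 + (k - 3))]: each direction other than [i] has
    two Hermite data at each of two ends, and [k - 3] moments. *)
Lemma sum_diag_dofs (i j l : 'I_3) : uniq [:: i; j; l] ->
  (\sum_(s <- diag_dofs k i j l) spec_size s = (k - 1) * (k + 1) * (k + 1))%N.
Proof.
rewrite /= !inE negb_or !andbT => /andP[/andP[ij il] jl].
have [ji li lj] : [/\ j != i, l != i & l != j] by rewrite ![_ == i]eq_sym [l == j]eq_sym.
have [k2 _ k4] := nexp_sub.
rewrite !big_cons big_nil /spec_size !(prod_ord3_perm _ ij il jl) /support_axes /bound /=.
rewrite !inE !eqxx ?(negPf ij) ?(negPf il) ?(negPf jl) ?(negPf ji) ?(negPf li) ?(negPf lj) /=.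
rewrite ?eqxx ?(negPf ij) ?(negPf il) ?(negPf jl) ?(negPf ji) ?(negPf li) ?(negPf lj) /= ?k2 ?k4.
(* Writing [k = n + 3] removes the truncated subtractions and leaves a polynomial identity in
   [n]. *)
have [n ->] : exists n, k = (n + 3)%N by exists (k - 3)%N; lia.
rewrite addnK (_ : n + 3 - 1 = n + 2)%N; last by lia.
ring.
Qed.

(** The expansion of [(2 + (k - 2)) * (2 + (k - 2)) * (4 + (k - 3))], with the last factor for
    direction [l]. *)
Lemma sum_offdiag_dofs (i j l : 'I_3) : uniq [:: i; j; l] ->
  (\sum_(s <- offdiag_dofs k i j l) spec_size s = k * k * (k + 1))%N.
Proof.
rewrite /= !inE negb_or !andbT => /andP[/andP[ij il] jl].
have [ji li lj] : [/\ j != i, l != i & l != j] by rewrite ![_ == i]eq_sym [l == j]eq_sym.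
have [_ k3' k4] := nexp_sub.
rewrite !big_cons big_nil /spec_size !(prod_ord3_perm _ ij il jl) /support_axes /bound /=.
rewrite !inE !eqxx ?(negPf ij) ?(negPf il) ?(negPf jl) ?(negPf ji) ?(negPf li) ?(negPf lj) /=.
rewrite ?eqxx ?(negPf ij) ?(negPf il) ?(negPf jl) ?(negPf ji) ?(negPf li) ?(negPf lj) /= ?k3' ?k4.
have [n ->] : exists n, k = (n + 3)%N by exists (k - 3)%N; lia.
rewrite addnK (_ : n + 3 - 2 = n + 1)%N; last by lia.
ring.
Qed.

Lemma size_dofs (T : @box R) (B : @box R -> seq ('I_3 * int) -> seq (R3 R -> R)) :
  (forall G d, is_basis (@Qspace R d) (B G d)) ->
  size (dofs k T B) = (3 * ((k - 1) * (k + 1) * (k + 1)) + 3 * (k * k * (k + 1)))%N.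
Proof.
move=> Bb; rewrite size_flatten sumnE big_map big_map.
under eq_bigr do rewrite size_dof_group //.
rewrite /dofspecs !big_cat !sum_diag_dofs // !sum_offdiag_dofs //=; lia.
Qed.

End Count.

(** * Unisolvence *)

Section Unisolvence.
Context {R : realType}.
Variables (k : nat) (k3 : (3 <= k)%N).

Lemma Sigma_polyfun (u : @field3 R) a b : Sigma k u -> polyfun (entry u a b).
Proof.
by move=> /(Sigma_entry a b k3)[n [c [e [_ ->]]]]; exists n, c, e.
Qed.

Lemma Qspace_linear d a (f g : R3 R -> R) : Qspace d f -> Qspace d g -> Qspace d (a *: f + g).
Proof.
have QE h : Qspace d h <-> poly_lt (nexp \o bound d) h.
  split=> [/Qspace_psum[n [c [e [eb ->]]]]|]; last exact: poly_lt_Qspace.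
  by exists n, c, e; split => // r m; rewrite /= ltn_nexp.
by move=> /QE fQ /QE gQ; apply/QE; exact: poly_lt_linear.
Qed.

Lemma unisolvent_dofs (T : @box R) (B : @box R -> seq ('I_3 * int) -> seq (R3 R -> R)) :
  is_cell T -> (forall G d, is_basis (@Qspace R d) (B G d)) ->
  unisolvent (Sigma k) (dofs k T B).
Proof.
move=> cT Bb.
apply: (@unisolvent_separating _ _ _ (Sigma0 k3) (Sigma_linear k3) _ _ (is_basis_Sigma k3)).
- by rewrite size_dofs // size_map -cardE card_sigma_index.
- move=> r hr; have /flattenP[_ /mapP[s ss ->]] := mem_nth (fun=> 0) hr.
  case/allpairsPdep => G [p [GT pB ->]] a u v Su Sv.
  apply: dof_linearl; try exact: Sigma_polyfun.
  move: pB; rewrite /test_basis; case E : (test s) => [|t d].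
    by rewrite inE => /eqP -> x; exact: cvg_cst.
  by move=> /(proj1 (Bb _ _))/Qspace_polyfun/polyfun_continuous.
move=> u Su u0.
have dof0 s G p : s \in dofspecs k -> G \in entities T (support_axes s) ->
    p \in test_basis B G (test s) -> dof s G p u = 0.
  move=> ss GT pB.
  have : dof s G p \in dofs k T B.
    apply/flattenP; exists [seq dof s G p | G <- entities T (support_axes s),
      p <- test_basis B G (test s)]; first by apply/mapP; exists s.
    by apply/allpairsPdep; exists G, p.
  by move=> /(nthP (fun=> 0))[r hr <-]; exact: u0.
(* Linearity in the test function extends the vanishing from the given basis to all of [Qspace], so
   that the monomials [conds_mono] may be used. *)
have dofQ0 s G p : s \in dofspecs k -> G \in entities T (support_axes s) ->
    Qspace (test s) p -> dof s G p u = 0.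
  move=> ss GT Qp.
  have us := Sigma_polyfun (row_ s) (col_ s) Su.
  have lin : linear_on (Qspace (test s)) (fun p => dof s G p u).
    move=> a f g /Qspace_polyfun/polyfun_continuous cf /Qspace_polyfun/polyfun_continuous cg.
    exact: dof_linearr.
  case E : (test s) => [|t d]; last first.
    have [bB spanB] := Bb G (test s).
    have [c [-> _]] := spanB p Qp.
    have [|_ ->] := @linear_on_sum _ _ _ (Qspace0 _) (@Qspace_linear _) _ _ (c 0)
      (fun r => (B G (test s))`_r) lin.
      by move=> r; apply/bB/mem_nth.
    rewrite big1 // => r _; rewrite dof0 ?mulr0 //.
    by rewrite (_ : test_basis B G (test s) = B G (test s)) ?mem_nth // E.
  (* At a vertex the admissible [p] are the constants; the summand [0] puts [p] in the form required
     by [linear_on]. *)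
  have -> : p = p 0 *: (fun=> 1) + 0.
    move: Qp; rewrite E => /Qspace_psum[n [c [e [eb ->]]]].
    apply/funext => x; transitivity (psum c e 0 * 1 + 0); last by [].
    rewrite mulr1 addr0; apply: eq_bigr => r _; congr (_ * _); apply: eq_bigr => m _.
    have := eb r m; rewrite bound_notin // lez_nat leqn0 => /eqP ->.
    by rewrite !expr0.
  have Q1 : Qspace (test s) (fun=> 1 : R).
    rewrite E; apply/Qspace_psum; exists 1%N, (fun=> 1), (fun _ _ => 0%N).
    split; first by move=> *; rewrite bound_notin.
    by apply/funext => x; rewrite /psum big_ord1 /mono big1 ?mulr1 // => m _; rewrite expr0.
  rewrite (lin (p 0) _ _ Q1 (Qspace0 _)) dof0 ?mulr0 ?add0r ?E ?mem_head //.
  by have := lin 1 _ _ (Qspace0 _) (Qspace0 _); rewrite scale1r addr0 mul1r => /eqP;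
    rewrite addrC -subr_eq subrr => /eqP.
have upper (a b : 'I_3) : (a <= b)%N -> forall y, entry u a b y = 0.
  move=> ab y; have [n [c [e [eb eE]]]] := Sigma_entry a b k3 Su.
  rewrite eE; apply: (psum_eq0 k3 cT eb) => x vx.
  have [m t|s ss fs] := @spec_exists k a b (fun m => (x m).1.1) ab.
    by move=> xm; have := vx m; rewrite /valid_cond xm.
  rewrite -(dof_conds cT vx fs eE); apply: dofQ0 => //.
    exact: entities_conds fs.
  exact: Qspace_conds_mono vx fs.
apply/funext => y; apply/matrixP => a b; rewrite [RHS]mxE.
have [ab|ba] := leqP a b; first exact: upper.
have [us _] := Su; have := upper b a (ltnW ba) y; rewrite /entry => <-.
by rewrite -[in LHS]us mxE.
Qed.

End Unisolvence.

(** * Faces of the mesh *)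

Section Faces.
Context {R : realType}.
Implicit Types (T : @box R) (x y : R3 R).

Definition endpoint T (m : 'I_3) (v : bool) : R := coord (if v then T.2 else T.1) m.

Definition face T (l : 'I_3) (v : bool) : box :=
  subbox T [ffun m => if m == l then Some v else None].

Definition strictly_inside T x := forall m, coord T.1 m < coord x m < coord T.2 m.

Lemma box_subbox_endpoint T s x m v : box_set (subbox T s) x -> s m = Some v ->
  coord x m = endpoint T m v.
Proof.
move=> /(_ m); rewrite coord_subbox1 coord_subbox2 => + sm; rewrite sm.
by case: v {sm} => /= /andP[h1 h2]; apply/eqP; rewrite eq_le h1 h2.
Qed.

Lemma face_eq T T' l v v' : is_cell T -> is_cell T' -> face T l v = face T' l v' ->
  endpoint T l v = endpoint T' l v' /\
  forall m, m != l -> forall w, endpoint T m w = endpoint T' m w.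
Proof.
move=> cT cT' ff.
have E1 m : coord (face T l v).1 m = coord (face T' l v').1 m by rewrite ff.
have E2 m : coord (face T l v).2 m = coord (face T' l v').2 m by rewrite ff.
split.
  have := E1 l; have := E2 l; rewrite !coord_subbox1 !coord_subbox2 !ffunE eqxx.
  by case: v v' {ff E1 E2} => [] [] /=.
move=> m /negPf ml w; have := E1 m; have := E2 m.
by rewrite !coord_subbox1 !coord_subbox2 !ffunE ml; case: w.
Qed.

Variables (Om : set (R3 R)) (Th : seq (@box R)).
Hypotheses (oOm : open Om) (mesh : is_mesh Om Th).

Let cell T : T \in Th -> is_cell T.
Proof. by case: mesh => + _ _; apply. Qed.

(** Distinct cells meet at most in a proper subentity, on which some coordinate equals an end of
    [T]; this never happens strictly inside [T]. *)
Lemma strictly_inside_unique T T' x : T \in Th -> T' \in Th ->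
  strictly_inside T x -> box_set T' x -> T = T'.
Proof.
move=> TTh T'Th xT xT'; apply/eqP/negP => /negP TT'.
have xTT' : (box_set T `&` box_set T') x.
  by split=> // m; have /andP[h1 h2] := xT m; rewrite !ltW.
have [_ _ /(_ _ _ TTh T'Th TT')[E|[A [G [[m mA] GT _ GE]]]]] := mesh.
  by move: xTT'; rewrite E.
move: xTT'; rewrite GE; have /mem_entities[s [sA ->]] := GT => xG.
have := sA m; rewrite (negPf mA); case E : (s m) => [v|] // _.
have := box_subbox_endpoint xG E; have := xT m; rewrite /endpoint.
by case: v {E} => /andP[h1 h2] xE; move: h1 h2; rewrite xE ltxx.
Qed.

(** Both cells lie on the same side of their common face, so their interiors overlap next to it. *)
Lemma face_unique T T' l v : T \in Th -> T' \in Th -> face T l v = face T' l v -> T = T'.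
Proof.
move=> TTh T'Th ff; have cT := cell TTh; have cT' := cell T'Th.
have [el em] := face_eq cT cT' ff.
(* In direction [l], halfway between the common end and the nearer of the two opposite ends; in the
   other directions, the centre. *)
pose y := mkpt (fun m => if m == l then
    if v then (coord T.2 l + Num.max (coord T.1 l) (coord T'.1 l)) / 2
    else (coord T.1 l + Num.min (coord T.2 l) (coord T'.2 l)) / 2
  else (coord T.1 m + coord T.2 m) / 2).
have hl := cT l; have hl' := cT' l.
apply: (@strictly_inside_unique T T' y) => // m; rewrite coord_mkpt.
  have hm := cT m; case: eqP => [ml|_]; last by apply/andP; split; lra.
  move: el; rewrite /endpoint ml; case: v {y ff} => el.
    by have := le_max (coord T.1 l) (coord T.1 l) (coord T'.1 l);
      rewrite lexx /Num.max; case: ifP => h1 h2; apply/andP; split; lra.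
  by have := le_max (coord T.1 l) (coord T.1 l) (coord T'.1 l);
      rewrite lexx /Num.min; case: ifP => h1 h2; apply/andP; split; lra.
have hm := cT' m; case: eqP => [ml|/eqP ml].
  move: el; rewrite /endpoint ml; case: v {y ff} => el.
    rewrite /Num.max; case: ifP => [h1|/negbT]; rewrite -?leNgt => *; apply/andP; split; lra.
  rewrite /Num.min; case: ifP => [h1|/negbT]; rewrite -?leNgt => *; apply/andP; split; lra.
have e1 := em m ml true; have e2 := em m ml false; rewrite /endpoint in e1 e2.
apply/andP; split; lra.
Qed.

(** Provides the length of a step out of a cell that stays in a ball of radius [e] and reaches no
    mesh plane other than that of the face being crossed. *)
Lemma avoid_finite (E : seq R) (c e : R) : 0 < e -> exists2 d, 0 < d < e &
  forall c', c' \in E -> c' != c -> d < `|c' - c|.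
Proof.
move=> e0; elim: E => [|c1 E [d /andP[d0 de] dE]].
  by exists (e / 2) => //; apply/andP; split; lra.
have [c1c|c1c] := eqVneq c1 c.
  exists d; first by rewrite d0.
  by move=> c'; rewrite inE => /orP[/eqP ->|/dE //]; rewrite c1c eqxx.
have n0 : 0 < `|c1 - c| by rewrite normr_gt0 subr_eq0.
exists (Num.min d (`|c1 - c| / 2)).
  by rewrite lt_min d0 divr_gt0 //= gt_min de.
move=> c'; rewrite inE => /orP[/eqP -> _|c'E c'c].
  by rewrite gt_min; apply/orP; right; lra.
by rewrite gt_min dE.
Qed.

Definition in_face T l v x := coord x l = endpoint T l v /\
  forall m, m != l -> coord T.1 m < coord x m < coord T.2 m.

(** A point just across the face lies in [Om], hence in a cell [T']. No other parallel mesh plane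
    was reached, so [T'] extends back to [x] and meets [T] in a subentity containing [x]; as [x] is
    interior to the face, that subentity is the face. *)
Lemma neighbour_exists T l v x : T \in Th -> in_face T l v x -> Om x ->
  exists2 T', T' \in Th & face T' l (~~ v) = face T l v.
Proof.
move=> TTh [xl xm] Omx; have cT := cell TTh; have [_ clOm meet] := mesh.
have /nbhs_ballP[e /= e0 eOm] : nbhs x Om by exact: open_nbhs_nbhs.
have [d /andP[d0 de] dE] := avoid_finite
  ([seq coord (p : box).1 l | p <- Th] ++ [seq coord (p : box).2 l | p <- Th])
  (endpoint T l v) e0.
pose c := endpoint T l v; pose y := upd x l (if v then c + d else c - d).
have yOm : Om y.
  apply: eOm; have yx m : `|coord x m - coord y m| < e.
    rewrite coord_upd; case: eqP => [->|_]; last by rewrite subrr normr0.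
    by rewrite xl ltr_norml /c; case: (v); apply/andP; split; lra.
  by split; [split; [exact: (yx ax1)|exact: (yx ax2)]|exact: (yx ax3)].
have [T' T'Th yT'] : (\bigcup_(T in [set` Th]) box_set T) y.
  by rewrite -clOm; exact: subset_closure.
(* [T'] extends beyond [c] on the outer side and comes back at least to [c]: an end of [T'] strictly
   past [c] and not past [y] would be within [d] of [c], against [dE]. *)
have [lo hi] : (if v then coord T'.1 l <= c else coord T'.1 l < c) /\
    (if v then c < coord T'.2 l else c <= coord T'.2 l).
  have := yT' l; rewrite coord_upd eqxx => /andP[h1 h2].
  have d1 : coord T'.1 l != c -> d < `|coord T'.1 l - c|.
    by apply: dE; rewrite mem_cat (map_f (fun p : box => coord p.1 l)).
  have d2 : coord T'.2 l != c -> d < `|coord T'.2 l - c|.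
    by apply: dE; rewrite mem_cat (map_f (fun p : box => coord p.2 l)) ?orbT.
  case: (v) h1 h2 => h1 h2; split; try lra.
    rewrite leNgt; apply/negP => h3; have := d1 (negbT (gt_eqF h3)).
    by rewrite ger0_norm ?subr_ge0 ?ltW //; lra.
  rewrite leNgt; apply/negP => h3.
  have := d2 (negbT (lt_eqF h3)); rewrite ltr0_norm ?subr_lt0 //; lra.
have xT' : box_set T' x.
  move=> m; have [->|ml] := eqVneq m l; last by have := yT' m; rewrite coord_upd (negPf ml).
  by rewrite xl -/c; case: (v) lo hi => lo hi; apply/andP; split; lra.
have xT : box_set T x.
  move=> m; have [->|ml] := eqVneq m l; last by have /andP[h1 h2] := xm _ ml; rewrite !ltW.
  by rewrite xl /endpoint; have := cT l; case: (v) => h; rewrite lexx ?ltW.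
have TT' : T != T'.
  apply/eqP => E; have := yT' l; rewrite -E coord_upd eqxx /c /endpoint.
  by case: (v) => /andP[]; lra.
have [E|[A [G [[m0 m0A] GT GT' GE]]]] := meet _ _ TTh T'Th TT'.
  by have : (box_set T `&` box_set T') x by []; rewrite E.
have xG : box_set G x by rewrite -GE.
have /mem_entities[s [sA sE]] := GT; have /mem_entities[s' [sA' sE']] := GT'.
have sm m : m != l -> s m = None.
  move=> ml; case E : (s m) => [w|//]; have := xm m ml.
  rewrite sE in xG; rewrite (box_subbox_endpoint xG E) /endpoint.
  by case: (w); rewrite !ltxx ?andbF.
(* A proper subentity freezes at least one direction, and by [sm] only [l] can be frozen. *)
have lA : l \notin A.
  have [<-//|m0l] := eqVneq m0 l.
  by move: m0A; rewrite -sA sm.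
have sl : s l = Some v.
  have := sA l; rewrite (negPf lA); case E : (s l) => [w|//] _; congr Some.
  rewrite sE in xG; have := box_subbox_endpoint xG E; rewrite xl /endpoint.
  by have := cT l; case: (v); case: (w) => //= h h'; move: h; rewrite h' ltxx.
have sl' : s' l = Some (~~ v).
  have := sA' l; rewrite (negPf lA); case E : (s' l) => [w|//] _; congr Some.
  rewrite sE' in xG; have := box_subbox_endpoint xG E; rewrite xl -/c /endpoint.
  by case: (v) lo hi => lo hi; case: (w) => //= h; move: lo hi; rewrite h ltxx.
exists T' => //; transitivity G; [rewrite sE'|rewrite sE]; rewrite /face; congr subbox.
  apply/ffunP => m; rewrite ffunE; have [->|ml] := eqVneq m l; first by rewrite sl'.
  by apply/esym/eqP; rewrite sA' -sA sm.
by apply/ffunP => m; rewrite ffunE; have [->|ml] := eqVneq m l; rewrite ?sl ?sm.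
Qed.

(** [x] may lie on the rim of the face: moving it slightly towards the centre of the face, without
    leaving [Om], gives a point to which [neighbour_exists] applies. *)
Lemma neighbour_exists_closed T l v x : T \in Th -> coord x l = endpoint T l v ->
  box_set T x -> Om x -> exists2 T', T' \in Th & face T' l (~~ v) = face T l v.
Proof.
move=> TTh xl xT Omx; have cT := cell TTh.
have /nbhs_ballP[e /= e0 eOm] : nbhs x Om by exact: open_nbhs_nbhs.
pose mid m := (coord T.1 m + coord T.2 m) / 2.
(* [M] exceeds every displacement [mid m - coord x m], so [t <= e / M] keeps [y] in the ball; the
   summand [1] makes these bounds strict. *)
pose M := 1 + \sum_m `|mid m - coord x m|.
have M1 m : `|mid m - coord x m| < M.
  rewrite /M (bigD1 m) //= addrCA ltrDl ltr_pwDl //.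
  by apply: sumr_ge0 => i _; exact: normr_ge0.
have M0 : 0 < M by rewrite (le_lt_trans _ (M1 ax1)).
pose t := Num.min (1 / 2) (e / M).
have t0 : 0 < t by rewrite lt_min divr_gt0 // divr_gt0.
have t1 : t < 1 by rewrite gt_min; apply/orP; left; lra.
have te : t * M <= e by rewrite -ler_pdivlMr // ge_min lexx orbT.
pose y := mkpt (fun m => if m == l then coord x m else coord x m + t * (mid m - coord x m)).
apply: (@neighbour_exists T l v y) => //.
  split; first by rewrite coord_mkpt eqxx.
  move=> m /negPf ml; rewrite coord_mkpt ml; have := cT m; have /andP[h1 h2] := xT m.
  rewrite /mid => h3; apply/andP; split; nra.
apply: eOm; have yx m : `|coord x m - coord y m| < e.
  rewrite coord_mkpt; case: eqP => [->|_]; first by rewrite subrr normr0.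
  rewrite opprD addrA subrr sub0r normrN normrM (gtr0_norm t0).
  by rewrite (lt_le_trans _ te) // ltr_pM2l.
by split; [split; [exact: (yx ax1)|exact: (yx ax2)]|exact: (yx ax3)].
Qed.

End Faces.

(** * Agreement of entries across a common face *)

Section Agreement.
Context {R : realType}.
Variables (k : nat) (k3 : (3 <= k)%N) (Th : seq (@box R)) (u : @box R -> @field3 R).
Hypothesis cells : forall T, T \in Th -> is_cell T.
Hypothesis uS : forall T, T \in Th -> Sigma k (u T).
Hypothesis shared : forall T T', T \in Th -> T' \in Th ->
  forall s, s \in dofspecs k -> (size (support_axes s) < 3)%N ->
  forall G, G \in entities T (support_axes s) -> G \in entities T' (support_axes s) ->
  forall p, Qspace (test s) p -> dof s G p (u T) = dof s G p (u T').

Lemma subbox_flip (T T' : @box R) l v (s : {ffun 'I_3 -> option bool}) :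
  is_cell T -> is_cell T' -> face T' l (~~ v) = face T l v -> s l = Some v ->
  subbox T s = subbox T' [ffun m => if m == l then Some (~~ v) else s m].
Proof.
move=> cT cT' ff sl; have [el em] := face_eq cT' cT ff.
have e1 m : m != l -> coord T.1 m = coord T'.1 m by move=> ml; have := em m ml false.
have e2 m : m != l -> coord T.2 m = coord T'.2 m by move=> ml; have := em m ml true.
rewrite /subbox; congr (_, _); apply: eq_pt => m; rewrite !coord_mkpt !ffunE.
  have [->|ml] := eqVneq m l; last by rewrite e1 ?e2.
  by rewrite sl; move: el; rewrite /endpoint; case: (v).
have [->|ml] := eqVneq m l; last by rewrite e1 ?e2.
by rewrite sl; move: el; rewrite /endpoint; case: (v).
Qed.

(** The difference of the two polynomials is again a shape function, and every condition required by
    [psum_face_eq0] lives on a subentity of the common face, where the two cells share their degrees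
    of freedom. *)
Lemma entries_agree_upper T T' l v (a b : 'I_3) y : T \in Th -> T' \in Th ->
  face T' l (~~ v) = face T l v -> (0 < hord a b l)%N -> (a <= b)%N ->
  coord y l = endpoint T l v -> entry (u T) a b y = entry (u T') a b y.
Proof.
move=> TTh T'Th ff hl ab yl; have cT := cells TTh; have cT' := cells T'Th.
pose w := (-1) *: u T' + u T.
have wS : Sigma k w by apply: (Sigma_linear k3); exact: uS.
have [n [c [e [eb eE]]]] := Sigma_entry a b k3 wS.
suff : entry w a b y = 0.
  have -> : entry w a b y = - entry (u T') a b y + entry (u T) a b y.
    transitivity (((-1) *: u T' y + u T y) a b); first by [].
    by rewrite !mxE mulN1r.
  by move=> /eqP; rewrite addrC subr_eq0 => /eqP.
rewrite eE; apply: (psum_face_eq0 k3 cT eb _ yl hl) => x vx xl.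
have [m t|s ss fs] := @spec_exists k a b (fun m => (x m).1.1) ab.
  by move=> xm; have := vx m; rewrite /valid_cond xm.
rewrite -(dof_conds cT vx fs eE).
have Qx : Qspace (test s) (conds_mono x : R3 R -> R) := Qspace_conds_mono k3 vx fs.
have [ra cb [ud us] [_ sm] _] := fs.
rewrite dof_linearl ?ra ?cb; [|by apply: (Sigma_polyfun k3); exact: uS|by apply: (Sigma_polyfun k3); exact: uS
  |exact: (polyfun_continuous (Qspace_polyfun Qx))].
have GT := entities_conds T fs.
rewrite (shared TTh T'Th ss _ GT _ Qx); first by rewrite mulN1r addNr.
  (* Since [l] is not a support axis, at most two axes remain and the functional is attached to a
     vertex, edge or face, as [shared] demands. *)
  have lns : l \notin support_axes s by rewrite sm xl.
  have : uniq (l :: support_axes s) by rewrite /= lns us.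
  by move/uniq_leq_size => /(_ (enum 'I_3)); rewrite size_enum_ord; apply => i _; rewrite mem_enum.
apply/mem_entities; exists [ffun m => if m == l then Some (~~ v) else conds_entity x m]; split.
  move=> m; rewrite ffunE sm; have [->|_] := eqVneq m l; first by rewrite xl.
  by rewrite ffunE; case: (x m).1.1.
by apply: subbox_flip => //; rewrite ffunE xl.
Qed.

Lemma entries_agree T T' l v (a b : 'I_3) y : T \in Th -> T' \in Th ->
  face T' l (~~ v) = face T l v -> (0 < hord a b l)%N ->
  coord y l = endpoint T l v -> entry (u T) a b y = entry (u T') a b y.
Proof.
move=> TTh T'Th ff hl yl; have [ab|ba] := leqP a b.
  exact: entries_agree_upper ff hl ab yl.
have sym T0 : T0 \in Th -> entry (u T0) a b y = entry (u T0) b a y.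
  by move=> /uS[us _]; rewrite /entry -[in LHS]us mxE.
rewrite !sym //; apply: entries_agree_upper ff _ (ltnW ba) yl => //.
by rewrite hordC.
Qed.

End Agreement.

(** * Cancellation of face integrals *)

Section Cancellation.
Context {R : realType}.

Lemma big_seq_unique (I : eqType) (r : seq I) (P : pred I) (h : R) :
  uniq r -> {in r &, forall x y, P x -> P y -> x = y} ->
  \sum_(x <- r | P x) h = if has P r then h else 0.
Proof.
move=> ur uP; case: ifPn => [/hasP[x xr Px]|/hasPn rP].
  rewrite big_mkcond (bigD1_seq x) //= Px big1_seq ?addr0 // => y /andP[yx yr].
  by case: ifP => // Py; case/eqP: yx; exact: uP.
by rewrite big_seq_cond big1 // => x /andP[xr Px]; have := rP x xr; rewrite Px.
Qed.

(** [P] is a partial matching, and both sums equal the double sum over matched pairs because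
    unmatched terms vanish. It is applied with [P] pairing the upper face of one cell with the lower
    face of another. *)
Lemma sum_match (I : eqType) (r : seq I) (P : rel I) (f g : I -> R) : uniq r ->
  (forall x y z, x \in r -> y \in r -> z \in r -> P x y -> P x z -> y = z) ->
  (forall x y z, x \in r -> y \in r -> z \in r -> P x z -> P y z -> x = y) ->
  (forall x, x \in r -> ~~ has (P x) r -> f x = 0) ->
  (forall y, y \in r -> ~~ has (P^~ y) r -> g y = 0) ->
  (forall x y, x \in r -> y \in r -> P x y -> f x = g y) ->
  \sum_(x <- r) f x = \sum_(y <- r) g y.
Proof.
move=> ur uP1 uP2 f0 g0 fg.
have fE : \sum_(x <- r) f x = \sum_(x <- r) \sum_(y <- r | P x y) f x.
  rewrite big_seq [RHS]big_seq; apply: eq_bigr => x xr.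
  rewrite big_seq_unique //; first by case: ifPn => // /f0 ->.
  by move=> y z yr zr; exact: uP1.
have gE : \sum_(y <- r) g y = \sum_(y <- r) \sum_(x <- r | P x y) g y.
  rewrite big_seq [RHS]big_seq; apply: eq_bigr => y yr.
  rewrite big_seq_unique //; first by case: ifPn => // /g0 ->.
  by move=> x z xr zr Px Pz; exact: uP2 xr zr yr Px Pz.
rewrite fE gE (exchange_big_dep predT) //= big_seq [RHS]big_seq.
apply: eq_bigr => y yr; rewrite big_seq_cond [RHS]big_seq_cond.
by apply: eq_bigr => x /andP[xr Pxy]; exact: fg.
Qed.

End Cancellation.

(** * The weak curl of a finite element field *)

Section RealIntegrals.
Context d (T : measurableType d) (R : realType) (mu : {measure set T -> \bar R}).

Lemma Rintegral_sum (D : set T) (I : eqType) (s : seq I) (F : I -> T -> R) :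
  measurable D -> (forall i, i \in s -> mu.-integrable D (EFin \o F i)) ->
  \int[mu]_(x in D) (\sum_(i <- s) F i x) = \sum_(i <- s) \int[mu]_(x in D) F i x.
Proof.
move=> mD; elim: s => [|i s IH] Fi.
  under eq_Rintegral do rewrite big_nil.
  by rewrite big_nil Rintegral_cst // mul0r.
have Fs : mu.-integrable D (EFin \o (fun x => \sum_(j <- s) F j x)).
  have -> : EFin \o (fun x => \sum_(j <- s) F j x) =
      fun x => (\sum_(j <- s | j \in s) (F j x)%:E)%E.
    by apply/funext => x /=; rewrite -sumEFin big_seq.
  by apply: integrable_sum => // j js; apply: Fi; rewrite in_cons js orbT.
under eq_Rintegral do rewrite big_cons.
rewrite big_cons RintegralD ?IH //.
- by move=> j js; apply: Fi; rewrite in_cons js orbT.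
- by apply: Fi; rewrite mem_head.
Qed.

Lemma Lfun2_restrict (D : set T) (p : T -> R) : measurable D -> (mu D < +oo)%E ->
  measurable_fun D p -> [bounded p x | x in D] -> p \_ D \in Lfun mu 2%:E.
Proof.
move=> mD Doo mp bp.
have mpD : measurable_fun setT (p \_ D) by exact/(measurable_restrictT _ mD).
rewrite inE; apply/andP; split; rewrite inE //=.
rewrite /finite_norm unlock poweR_lty //; apply/integrable_lty => //.
have -> : (fun x => `|(EFin \o p \_ D) x| `^ 2)%E =
    (EFin \o (fun x => (p x) ^+ 2)) \_ D :> (T -> \bar R).
  apply/funext => x; rewrite /= /patch; case: ifP => _.
    by rewrite /= -[2]/(2%:R) powR_mulrn // real_normK // num_real.
  by rewrite normr0 powR0 // pnatr_eq0.
apply/(integrable_mkcond _ mD); apply: measurable_bounded_integrable => //.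
  exact: measurable_realfun.measurable_funX.
have [M [Mr pM]] := bp; exists ((`|M| + 1) ^+ 2); split; first exact: num_real.
move=> N MN x Dx /=; rewrite (le_trans _ (ltW MN)) // normrX lerXn2r ?nnegrE //.
by apply: pM => //; rewrite (le_lt_trans (ler_norm M)) // ltrDl.
Qed.

End RealIntegrals.

Section Pieces.
Context {R : realType}.
Variables (Om : set (R3 R)) (oOm : open Om).

Lemma measurable_box (T : @box R) : measurable (box_set T : set (measurableTypeR R * measurableTypeR R * measurableTypeR R)%type).
Proof. by rewrite box_setE; apply: measurableX => //; exact: measurableX. Qed.

Lemma integrable_box (T : @box R) (f : R3 R -> R) : continuous f ->
  (@leb3 R).-integrable (box_set T) (EFin \o f).
Proof. by rewrite box_setE; exact: integrable_cont3. Qed.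

(** The cells lie only in the closure of [Om]; as the integrands vanish off [Om], each piece may be
    integrated over its full box, where [box_divergence] applies. *)
Lemma Rintegral_pieces (r : seq (@box R)) (F : @box R -> R3 R -> R) :
  (forall T, T \in r -> continuous (F T)) ->
  (forall T x, T \in r -> ~ Om x -> F T x = 0) ->
  \int[leb3]_(x in Om) (\sum_(T <- r) \1_(box_set T) x * F T x) =
  \sum_(T <- r) \int[leb3]_(x in box_set T) F T x.
Proof.
move=> cF F0; rewrite Rintegral_mkcond.
under eq_Rintegral => x _.
  rewrite (_ : _ x = \sum_(T <- r) ((F T) \_ (box_set T)) x); last first.
    have E : \sum_(T <- r) \1_(box_set T) x * F T x = \sum_(T <- r) ((F T) \_ (box_set T)) x.
      by apply: eq_bigr => T _; rewrite indicE /patch; case: ifP => _; rewrite ?mul1r ?mul0r.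
    rewrite [LHS]/patch; case: ifPn => // xOm; apply/esym; rewrite big_seq big1 // => T Tr.
    rewrite /patch; case: ifP => // _; apply: F0 => // Omx.
    by case/negP: xOm; exact: mem_set.
  over.
rewrite Rintegral_sum //; first by apply: eq_bigr => T _; rewrite -Rintegral_mkcond.
move=> T Tr; rewrite -restrict_EFin.
by apply/(integrable_mkcond _ (measurable_box T)); apply: integrable_box; exact: cF.
Qed.

Lemma box_pieces_L2 (r : seq (@box R)) (F : @box R -> R3 R -> R) :
  (forall T, T \in r -> continuous (F T)) ->
  L2 Om (fun x => \sum_(T <- r) \1_(box_set T) x * F T x).
Proof.
move=> cF; rewrite /L2 /=.
have mOm : measurable (Om : set (measurableTypeR R * measurableTypeR R * measurableTypeR R)%type).
  exact: open_measurable3.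
have -> : (fun x => \sum_(T <- r) \1_(box_set T) x * F T x) \_ Om =
    fun x => \sum_(T <- r) (F T \_ (box_set T `&` Om)) x.
  apply/funext => x; rewrite [LHS]/patch; case: ifPn => xOm.
    apply: eq_bigr => T _; rewrite indicE /patch in_setI xOm andbT.
    by case: ifP => _; rewrite ?mul1r ?mul0r.
  by apply/esym; rewrite big1 // => T _; rewrite /patch in_setI (negPf xOm) andbF.
have [L0 LD] := @Lfun_addr_closed _ _ _ (@leb3 R) 2%:E (ler1n _ 2).
elim: r cF => [|T r IH] cF.
  by rewrite (_ : (fun _ => _) = 0) //; apply/funext => x; rewrite big_nil.
rewrite (_ : (fun _ => _) = (F T \_ (box_set T `&` Om)) +
    (fun x => \sum_(T <- r) (F T \_ (box_set T `&` Om)) x)); last first.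
  by apply/funext => x; rewrite big_cons.
apply: LD; last by apply: IH => T' T'r; apply: cF; rewrite in_cons T'r orbT.
have mI : measurable (box_set T `&` Om : set (measurableTypeR R * measurableTypeR R * measurableTypeR R)%type).
  by apply: measurableI => //; exact: measurable_box.
have cT : continuous (F T) by apply: cF; rewrite mem_head.
apply: Lfun2_restrict => //.
- apply: (@le_lt_trans _ _ (leb3 (box_set T))).
    by apply: le_measure; rewrite ?inE; [exact: mI|exact: measurable_box|exact: subIsetl].
  by rewrite box_setE leb3_box_lty.
- by apply: measurable_funTS; exact: continuous_measurable3.
- have : [bounded F T x | x in box_set T].
    apply: compact_bounded_cont => //; rewrite box_setE.
    by apply: compact_setX; [apply: compact_setX|]; exact: segment_compact.
  by move=> [M [Mr pM]]; exists M; split => // N MN x [Tx _]; exact: pM.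
Qed.

Lemma leb2X (A B : set (measurableTypeR R)) : measurable A -> measurable B ->
  @leb2 R (A `*` B) = (@lebesgue_measure R A * @lebesgue_measure R B)%E.
Proof. by move=> mA mB; rewrite /leb2 product_measure1E. Qed.

Lemma leb3_hyperplane (m : 'I_3) (c : R) :
  {ae @leb3 R, forall x : R3 R, coord x m != c}.
Proof.
suff N : (@leb3 R).-negligible [set x | coord x m = c].
  by apply: negligibleS N => x /= /negP/negPn/eqP.
have pt0 : (@lebesgue_measure R [set c] = 0)%E by rewrite lebesgue_measure_set1.
have sE : [set x : R3 R | coord x m = c] = if m == ax1 then ([set c] `*` setT) `*` setT
    else if m == ax2 then (setT `*` [set c]) `*` setT else setT `*` [set c].
  apply/seteqP; split => -[[x1 x2] x3]; elim/ord3P: m => /=.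
  - by rewrite /coord /= => ->.
  - by rewrite /coord /= => ->.
  - by rewrite /coord /= => ->.
  - by case=> -[].
  - by case=> -[].
  - by case.
rewrite sE; elim/ord3P: m {sE} => /=; eexists; split; try exact: subset_refl.
- by apply: measurableX => //; apply: measurableX.
- rewrite /leb3 product_measure1E //; last exact: measurableX.
  apply/eqP; rewrite mule_eq0; apply/orP; left; apply/eqP.
  by apply: (eq_trans (leb2X _ _)) => //; rewrite pt0 mul0e.
- by apply: measurableX => //; apply: measurableX.
- rewrite /leb3 product_measure1E //; last exact: measurableX.
  apply/eqP; rewrite mule_eq0; apply/orP; left; apply/eqP.
  by apply: (eq_trans (leb2X _ _)) => //; rewrite pt0 mule0.
- exact: measurableX.
- rewrite /leb3 product_measure1E //.
  by apply/eqP; rewrite mule_eq0; apply/orP; right; apply/eqP; exact: pt0.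
Qed.

End Pieces.

Section Conformity.
Context {R : realType}.
Variables (k : nat) (k3 : (3 <= k)%N) (Om : set (R3 R)) (Th : seq (@box R)).
Variable u : @box R -> @field3 R.
Hypothesis oOm : open Om.
Hypothesis mesh : is_mesh Om Th.
Hypothesis uS : forall T, T \in Th -> Sigma k (u T).
Hypothesis shared : forall T T', T \in Th -> T' \in Th ->
  forall s, s \in dofspecs k -> (size (support_axes s) < 3)%N ->
  forall G, G \in entities T (support_axes s) -> G \in entities T' (support_axes s) ->
  forall p, Qspace (test s) p -> dof s G p (u T) = dof s G p (u T').

Let cells T : T \in Th -> is_cell T.
Proof. by case: mesh => + _ _; apply. Qed.

Lemma test_function_out (phi : R3 R -> R) x : test_function Om phi -> ~ Om x -> phi x = 0.
Proof.
move=> [_ _ _ supp] xOm; apply/eqP; apply: contrapT => /negP px.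
by apply: xOm; apply: supp; exact: subset_closure.
Qed.

(** A point off [Om] has a neighbourhood disjoint from the support, on which [phi] is identically
    zero. *)
Lemma test_function_partial_out (phi : R3 R -> R) x m : test_function Om phi ->
  ~ Om x -> partial m phi x = 0.
Proof.
move=> [_ _ _ supp] xOm.
have : nbhs x (~` closure [set y | phi y != 0]).
  apply: open_nbhs_nbhs; split; first exact/closed_openC/closed_closure.
  by move=> /supp.
move=> nx; rewrite /partial; transitivity ('D_(unitv m) (cst (0 : R)) x); last first.
  exact: derive_cst.
apply: near_eq_derive.
apply: filterS nx => y yS; apply/eqP; apply: contrapT => /negP py.
by apply: yS; exact: subset_closure.
Qed.

Section TestFunction.
Variable phi : R3 R -> R.
Hypothesis phiT : test_function Om phi.

Let cphi : continuous phi.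
Proof. by case: phiT => /(_ [::]). Qed.

Let cdphi m : continuous (partial m phi).
Proof. by case: phiT => /(_ [:: m]). Qed.

Let centry T (a b : 'I_3) : T \in Th -> continuous (entry (u T) a b).
Proof. by move=> /uS uT; exact/polyfun_continuous/(Sigma_polyfun k3). Qed.

Let cdentry T (a b m : 'I_3) : T \in Th -> continuous (partial m (entry (u T) a b)).
Proof.
by move=> /uS uT; exact/polyfun_continuous/polyfun_partial/(Sigma_polyfun k3).
Qed.

Definition leibniz (T : @box R) (a b m : 'I_3) : R3 R -> R := fun x =>
  partial m (entry (u T) a b) x * phi x + entry (u T) a b x * partial m phi x.

Lemma continuous_leibniz T a b m : T \in Th -> continuous (leibniz T a b m).
Proof.
move=> TTh x; apply: cvgD; apply: cvgM;
  [exact: cdentry|exact: cphi|exact: centry|exact: cdphi].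
Qed.

Lemma is_derive_leibniz T a b m x (t : R) : T \in Th ->
  is_derive t 1 (fun t => entry (u T) a b (upd x m t) * phi (upd x m t))
    (leibniz T a b m (upd x m t)).
Proof.
move=> TTh; have [_ dphi _ _] := phiT.
have d1 := is_derive_upd (fun y => @polyfun_derivable _ m _ y (Sigma_polyfun k3 a b (uS TTh))) x t.
have d2 := is_derive_upd (fun y => dphi [::] y m) x t.
have d3 := is_deriveM d1 d2.
by apply: (is_derive_eq d3); rewrite /leibniz /GRing.scale /= addrC [phi _ * _]mulrC.
Qed.

Lemma face_int_matching T T' a b m : T \in Th -> T' \in Th ->
  (0 < hord a b m)%N -> face T m true = face T' m false ->
  face_int T m (coord T.2 m) (fun x => entry (u T) a b x * phi x) =
  face_int T' m (coord T'.1 m) (fun x => entry (u T') a b x * phi x).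
Proof.
move=> TTh T'Th hm ff; have [el em] := face_eq (cells TTh) (cells T'Th) ff.
have [ne1 ne2] : other1 m != m /\ other2 m != m by elim/ord3P: m {hm ff el em}.
rewrite /face_int.
have e1 : coord T.1 (other1 m) = coord T'.1 (other1 m) by exact: (em _ ne1 false).
have e2 : coord T.2 (other1 m) = coord T'.2 (other1 m) by exact: (em _ ne1 true).
have e3 : coord T.1 (other2 m) = coord T'.1 (other2 m) by exact: (em _ ne2 false).
have e4 : coord T.2 (other2 m) = coord T'.2 (other2 m) by exact: (em _ ne2 true).
rewrite e1 e2 e3 e4.
rewrite /endpoint in el; rewrite -el; apply: eq_Rintegral => st _; congr (_ * _).
apply: (@entries_agree _ k k3 Th u cells uS shared T T' m true) => //.
by rewrite /face_pt coord_mkpt eqxx.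
Qed.

(** A point of the face where [phi] is nonzero lies in [Om] and would provide a neighbour; the
    integral includes the rim, hence the appeal to [neighbour_exists_closed]. *)
Lemma face_int_boundary T a b m v : T \in Th ->
  (forall T', T' \in Th -> face T' m (~~ v) <> face T m v) ->
  face_int T m (endpoint T m v) (fun x => entry (u T) a b x * phi x) = 0.
Proof.
move=> TTh nT; have cT := cells TTh; rewrite /face_int.
rewrite (@eq_Rintegral _ _ _ _ _ (cst 0)) ?Rintegral_cst ?mul0r //.
  exact: measurableX.
move=> st /set_mem[/= st1 st2].
suff -> : phi (face_pt (other1 m) (other2 m) m (endpoint T m v) st) = 0 by rewrite mulr0.
apply: contrapT => px; set x := face_pt _ _ _ _ _ in px.
have Omx : Om x by apply: contrapT => /(test_function_out phiT).
have xl : coord x m = endpoint T m v by rewrite coord_mkpt eqxx.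
have xT : box_set T x.
  move=> i; have [->|im] := eqVneq i m.
    by rewrite xl /endpoint; have := cT m; case: (v) => h; rewrite lexx ltW.
  rewrite coord_mkpt (negPf im).
  case: eqP => [->|/eqP io]; first by move: st1; rewrite in_itv.
  have -> : i = other2 m by move: im io; clear; elim/ord3P: m; elim/ord3P: i.
  by move: st2; rewrite in_itv.
have [T' T'Th ff] := neighbour_exists_closed oOm mesh TTh xl xT Omx.
exact: nT T'Th ff.
Qed.

(* A face that belongs to a single cell does not meet [Om], so [phi] vanishes
   on it. *)
Lemma sum_leibniz a b m : (0 < hord a b m)%N ->
  \sum_(T <- undup Th) \int[leb3]_(x in box_set T) leibniz T a b m x = 0.
Proof.
move=> hm.
pose h T v := face_int T m (endpoint T m v) (fun x => entry (u T) a b x * phi x).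
transitivity (\sum_(T <- undup Th) (h T true - h T false)).
  rewrite big_seq [RHS]big_seq; apply: eq_bigr => T; rewrite mem_undup => TTh.
  apply: (box_divergence (cells TTh)).
  - by move=> x; apply: cvgM; [exact: centry|exact: cphi].
  - exact: continuous_leibniz.
  - by move=> x t; exact: is_derive_leibniz.
rewrite sumrB; apply/eqP; rewrite subr_eq0; apply/eqP.
apply: (sum_match (P := fun T T' => face T m true == face T' m false)).
- exact: undup_uniq.
- move=> T T1 T2; rewrite !mem_undup => TTh T1Th T2Th /eqP e1 /eqP e2.
  by apply: (face_unique mesh T1Th T2Th (l := m) (v := false)); rewrite -e1.
- move=> T1 T2 T; rewrite !mem_undup => T1Th T2Th TTh /eqP e1 /eqP e2.
  by apply: (face_unique mesh T1Th T2Th (l := m) (v := true)); rewrite e1.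
- move=> T; rewrite mem_undup => TTh /hasPn nT; apply: face_int_boundary => // T' T'Th ff.
  by have := nT T'; rewrite mem_undup T'Th -ff eqxx => /(_ isT).
- move=> T; rewrite mem_undup => TTh /hasPn nT; apply: face_int_boundary => // T' T'Th ff.
  by have := nT T'; rewrite mem_undup T'Th -ff eqxx => /(_ isT).
- move=> T T'; rewrite !mem_undup => TTh T'Th /eqP ff; exact: face_int_matching.
Qed.

End TestFunction.

(* The closed cells overlap only on their faces, a null set. *)
Definition glued : @field3 R := fun x => \sum_(T <- undup Th) \1_(box_set T) x *: u T x.

Definition next (i : 'I_3) := if i == ax1 then ax2 else if i == ax2 then ax3 else ax1.

Definition glued_curl : @field3 R := fun x => \matrix_(r, i)
  \sum_(T <- undup Th) \1_(box_set T) x *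
    (partial (next i) (entry (u T) r (next (next i))) x -
     partial (next (next i)) (entry (u T) r (next i)) x).

Lemma entry_glued a b :
  entry glued a b = fun x => \sum_(T <- undup Th) \1_(box_set T) x * entry (u T) a b x.
Proof.
by apply/funext => x; rewrite /entry /glued summxE; apply: eq_bigr => T _; rewrite mxE.
Qed.

Lemma weak_curl_glued : weak_curl Om glued glued_curl.
Proof.
move=> phi phiT r i j l ijl.
have [cp _ _ _] := phiT.
have cphi : continuous phi := cp [::].
have cdphi m : continuous (partial m phi) := cp [:: m].
have pol T a b : T \in undup Th -> polyfun (entry (u T) a b).
  by rewrite mem_undup => /uS; exact: Sigma_polyfun.
have [-> -> jl lj] : [/\ j = next i, l = next (next i), j != l & l != j].
  by move: ijl; rewrite !inE => /or3P[] /eqP[-> -> ->].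
pose W T x := (partial (next i) (entry (u T) r (next (next i))) x -
     partial (next (next i)) (entry (u T) r (next i)) x) * phi x.
pose V T x := entry (u T) r (next i) x * partial (next (next i)) phi x -
     entry (u T) r (next (next i)) x * partial (next i) phi x.
have cW T : T \in undup Th -> continuous (W T).
  move=> TTh x; apply: cvgM; last exact: cphi.
  apply: cvgB; exact/polyfun_continuous/polyfun_partial/pol.
have cV T : T \in undup Th -> continuous (V T).
  move=> TTh x; apply: cvgB; apply: cvgM; try exact: cdphi;
  exact/polyfun_continuous/pol.
transitivity (\int[leb3]_(x in Om) (\sum_(T <- undup Th) \1_(box_set T) x * W T x)).
  apply: eq_Rintegral => x _; rewrite mxE big_distrl /=.
  by apply: eq_bigr => T _; rewrite mulrA.
transitivity (\int[leb3]_(x in Om) (\sum_(T <- undup Th) \1_(box_set T) x * V T x)); last first.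
  apply: eq_Rintegral => x _.
  have gE a b : glued x a b = \sum_(T <- undup Th) \1_(box_set T) x * entry (u T) a b x.
    by have := congr1 (fun f => f x) (entry_glued a b).
  rewrite !gE !big_distrl /= -sumrB; apply: eq_bigr => T _.
  by rewrite /V mulrBr !mulrA.
rewrite !Rintegral_pieces //; last 2 first.
- by move=> T x _ xOm; rewrite /V !(test_function_partial_out _ phiT xOm) !mulr0 subrr.
- by move=> T x _ xOm; rewrite /W (test_function_out phiT xOm) mulr0.
apply/eqP; rewrite -subr_eq0 -sumrB; apply/eqP.
(* The curl differentiates an entry only in directions other than its column, so the column index
   alone makes [hord] positive, whatever the row [r]. *)
have hl : (0 < hord r (next (next i)) (next i))%N.
  by rewrite /hord; elim/ord3P: i {ijl W V cW cV jl lj}; rewrite addn1.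
have hj : (0 < hord r (next i) (next (next i)))%N.
  by rewrite /hord; elim/ord3P: i {ijl W V cW cV jl lj hl}; rewrite addn1.
(* Cellwise integration by parts: [W - V] is the difference of the Leibniz integrands for the
   columns [next (next i)] and [next i], and each of these sums to zero over the cells. *)
rewrite -[RHS](subrr 0) -[in X in _ = X - _](sum_leibniz phiT hl) -[in X in _ = _ - X](sum_leibniz phiT hj).
rewrite -sumrB big_seq [RHS]big_seq; apply: eq_bigr => T TTh.
have TTh' : T \in Th by rewrite -mem_undup.
rewrite -!RintegralB; try exact: measurable_box; try by apply: integrable_box; auto.
- apply: eq_Rintegral => x _; rewrite /W /V /leibniz; ring.
- exact/integrable_box/continuous_leibniz.
- exact/integrable_box/continuous_leibniz.
Qed.

Lemma glued_L2 a b : L2 Om (entry glued a b).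
Proof.
rewrite entry_glued; apply: box_pieces_L2 => // T; rewrite mem_undup => /uS uT.
exact/polyfun_continuous/(Sigma_polyfun k3).
Qed.

Lemma glued_curl_L2 a b : L2 Om (entry glued_curl a b).
Proof.
have -> : entry glued_curl a b = fun x => \sum_(T <- undup Th) \1_(box_set T) x *
    (partial (next b) (entry (u T) a (next (next b))) x -
     partial (next (next b)) (entry (u T) a (next b)) x).
  by apply/funext => x; rewrite /entry mxE.
apply: box_pieces_L2 => // T; rewrite mem_undup => /uS uT x.
apply: cvgB; exact/polyfun_continuous/polyfun_partial/(Sigma_polyfun k3).
Qed.

Lemma strictly_inside_interior (T : @box R) x : strictly_inside T x -> (box_set T)^° x.
Proof.
move=> xT; have N m : \near x, coord T.1 m <= coord x m <= coord T.2 m.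
  have : nbhs (coord x m) `]coord T.1 m, coord T.2 m[%classic.
    by apply: open_nbhs_nbhs; split; [exact: interval_open|rewrite /= in_itv /= xT].
  move=> h; have cx : nbhs x (coord^~ m @^-1` `]coord T.1 m, coord T.2 m[).
    exact: (@continuous_coord R m x _ h).
  apply: filterS cx => y /=.
  by rewrite in_itv /= => /andP[h1 h2]; rewrite !ltW.
apply: filterS3 (N ax1) (N ax2) (N ax3) => y y1 y2 y3.
by elim/ord3P.
Qed.

Lemma glued_inside (T : @box R) x : T \in Th -> strictly_inside T x -> glued x = u T x.
Proof.
move=> TTh xT; rewrite /glued (bigD1_seq T) ?undup_uniq ?mem_undup //=.
rewrite indicE mem_set ?scale1r; last by move=> m; have /andP[h1 h2] := xT m; rewrite !ltW.
rewrite big1_seq ?addr0 // => T' /andP[T'T]; rewrite mem_undup => T'Th.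
rewrite indicE memNset ?scale0r // => xT'; case/eqP: T'T.
by apply/esym; exact: (strictly_inside_unique mesh TTh T'Th xT xT').
Qed.

#[local] Instance ae_leb3_filter : Filter (almost_everywhere (@leb3 R)).
Proof. exact: ae_filter_ringOfSetsType. Qed.

Lemma ae_seq (r : seq (@box R)) (P : @box R -> R3 R -> Prop) :
  (forall T, {ae @leb3 R, forall x, P T x}) ->
  {ae @leb3 R, forall x, forall T, T \in r -> P T x}.
Proof.
move=> aeP; elim: r => [|T r IH]; first exact: (filterS _ (filterT : almost_everywhere _ setT)).
by apply: filterS2 (aeP T) IH => x PT Pr T'; rewrite inE => /orP[/eqP ->|/Pr].
Qed.

Lemma Hcurl_glued (s : @field3 R) :
  (forall T, T \in Th -> forall x, (box_set T)^° x -> s x = u T x) -> Hcurl Om s.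
Proof.
move=> su; exists glued; split.
(* Off the finitely many planes carrying the faces of the cells, a point of [Om] lies strictly
   inside one cell, and only that cell contributes to [glued]. *)
- have h m : {ae @leb3 R, forall x, forall T, T \in Th ->
      coord x m != coord T.1 m /\ coord x m != coord T.2 m}.
    apply: (@ae_seq _ (fun T x => coord x m != coord T.1 m /\ coord x m != coord T.2 m)) => T.
    exact: (filterI (leb3_hyperplane m (coord T.1 m)) (leb3_hyperplane m (coord T.2 m))).
  apply: (@filterS _ (almost_everywhere (@leb3 R)) _ _ _ _
    (filterI (h ax1) (filterI (h ax2) (h ax3)))) => x [x1 [x2 x3]] Omx.
  have [_ clOm _] := mesh.
  have [T TTh xT] : (\bigcup_(T in [set` Th]) box_set T) x.
    by rewrite -clOm; exact: subset_closure.
  have sT : strictly_inside T x.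
    have [a1 b1] := x1 T TTh; have [a2 b2] := x2 T TTh; have [a3 b3] := x3 T TTh.
    have lt m : coord x m != coord T.1 m -> coord x m != coord T.2 m ->
        coord T.1 m < coord x m < coord T.2 m.
      move=> h1 h2; have /andP[h3 h4] := xT m.
      by rewrite !lt_neqAle h3 h4 h2 eq_sym h1.
    by elim/ord3P; exact: lt.
  by rewrite (glued_inside TTh sT); apply: su => //; exact: strictly_inside_interior.
- move=> x _; rewrite /glued linear_sum /= big_seq [RHS]big_seq.
  apply: eq_bigr => T; rewrite mem_undup => /uS[us _].
  by rewrite linearZ /= us.
- exact: glued_L2.
- by exists glued_curl; split; [exact: glued_curl_L2|exact: weak_curl_glued].
Qed.

End Conformity.

Theorem proposition3p3 (R : realType) (k : nat) (hk : (3 <= k)%N) :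
  (forall T : @box R, is_cell T ->
   forall B : @box R -> seq ('I_3 * int) -> seq (R3 R -> R),
     (forall G d, is_basis (@Qspace R d) (B G d)) ->
     unisolvent (Sigma k) (dofs k T B)) /\
  (forall (Om : set (R3 R)) (Th : seq (@box R)),
     is_domain Om -> contractible Om -> lipschitz_boundary Om -> is_mesh Om Th ->
     Sigma_h k Th `<=` Hcurl Om).
Proof.
split=> [T cT B Bb|Om Th [oOm _ _] _ _ mesh s [u [uS su shared]]].
  exact: unisolvent_dofs.
exact: (Hcurl_glued hk oOm mesh uS shared su).
Qed.
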